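(* If $\sigma$ satisfies condition (SY), then for $n\ge1$ $$(n+1)!\,\mathcal{B}_n=-2\,\partial_s^n\Big(\frac{\mathring{v}'}{\mathring{v}}\Big)\Big|_0+4\sum_{j=1}^nj\binom{n}{j}\,\partial_s^{j-1}(\rho)|_0\;\partial_s^{n-j}\Big(\frac{\mathring{v}'}{\mathring{v}}\Big)\Big|_0-2n\,\partial_s^{n-1}(\mathsf{J})|_0 .$$
   Context: Setting: $(X,g)$ is a compact Riemannian manifold of dimension $n+1$ with boundary $M$ (of dimension $n$), $\iota:M\hookrightarrow X$ the inclusion, $h=\iota^*(g)$. A boundary defining function is $\sigma\in C^\infty(X)$ (smooth up to the boundary) with $\sigma^{-1}(0)=M$, $\sigma>0$ on $X\setminus M$, $d\sigma|_M\neq0$. $\Delta_g=\operatorname{div}\operatorname{grad}$. Put $2n\,\mathsf{J}=\operatorname{scal}(g)$, $(n+1)\rho=-\Delta_g(\sigma)-\sigma\mathsf{J}$, $\mathcal{S}(g,\sigma)=|d\sigma|_g^2+2\sigma\rho$. Condition (SY): $\mathcal{S}(g,\sigma)=1+\sigma^{n+1}R_{n+1}$ near $M$ with $R_{n+1}$ smooth up to the boundary. The singular Yamabe obstruction is $\mathcal{B}_n=\iota^*(R_{n+1})\in C^\infty(M)$. Adapted coordinates: $\mathcal{N}=\operatorname{grad}_g(\sigma)$, $\mathfrak{X}=\mathcal{N}/|\mathcal{N}|^2$ near $M$, $\eta:[0,\varepsilon)\times M\to X$, $\eta(s,x)=\Phi^s_{\mathfrak{X}}(x)$ with $\Phi^s_{\mathfrak{X}}$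 the flow of $\mathfrak{X}$. Then $\eta$ is a diffeomorphism onto a neighborhood of $M$, $\eta^*(\sigma)=s$ and $\eta^*(g)=a^{-1}ds^2+h_s$ with $a=\eta^*(|\mathcal{N}|^2)$ and a one-parameter family $h_s$ of metrics on $M$, $h_0=h$. Put $\mathring{v}=dvol_{h_s}/dvol_h$, so that $\mathring{v}'/\mathring{v}=\frac12\operatorname{tr}(h_s^{-1}h_s')$. In the claim, $\mathsf{J}$ and $\rho$ denote the pull-backs $\eta^*(\mathsf{J})$ and $\eta^*(\rho)$, the prime is $\partial_s$, and $|_0$ is restriction to $s=0$. *)

(* Defs.v *)
From HB Require Import structures.
From mathcomp Require Import all_boot all_order all_algebra.
From mathcomp Require Import all_classical all_reals all_analysis.

Set Implicit Arguments.
Unset Strict Implicit.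
Unset Printing Implicit Defensive.

Import Order.TTheory GRing.Theory Num.Theory.
Import numFieldNormedType.Exports.

Local Open Scope classical_set_scope.
Local Open Scope ring_scope.

(* The directional derivative at [x] along [v] where only the points of [D] are
   used in the difference quotient: it is the usual two-sided one if [x] is
   interior to [D] and the one-sided one at a boundary point such as a point of
   the boundary hyperplane of a half-space. *)
Definition diffq {R : realType} {V W : normedModType R}
    (f : V -> W) (v x : V) (t : R) : W := t^-1 *: (f (x + t *: v) - f x).

Definition dirs_in {R : realType} {V : normedModType R} (D : set V) (v x : V) :
  set_system R := within [set t | D (x + t *: v)] 0^'.

Definition is_derive_in {R : realType} {V W : normedModType R}
    (D : set V) (f : V -> W) (v x : V) (w : W) : Prop :=
  diffq f v x @ dirs_in D v x --> w.

Definition derivable_in {R : realType} {V W : normedModType R}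
    (D : set V) (f : V -> W) (v x : V) : Prop :=
  cvg (diffq f v x @ dirs_in D v x).

Definition derive_in {R : realType} {V W : normedModType R}
    (D : set V) (f : V -> W) (v x : V) : W :=
  lim (diffq f v x @ dirs_in D v x).

(* [dpos k f s] is the k-th derivative of [f : [0, oo) -> R] at [s]
   (one-sided at [s = 0]). *)
Definition halfline {R : realType} : set R := [set t | 0 <= t].

Definition dpos {R : realType} (k : nat) (f : R -> R) : R -> R :=
  iter k (fun u s => derive_in (V := R^o) (W := R^o) halfline u 1 s) f.

Section HalfSpace.
Variables (R : realType) (n : nat).
Local Notation E := 'rV[R]_n.+1.

Definition halfspace : set E := [set z | 0 <= z 0 ord0].

Definition partial (i : 'I_n.+1) (f : E -> R) (z : E) : R :=
  derive_in (W := R^o) halfspace f (delta_mx 0 i) z.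

(* For [U] relatively open in [halfspace]: all partial derivatives up to order
   [k], one-sided in the normal direction at boundary points, exist and are
   continuous on [U]. *)
Fixpoint Ck_on (k : nat) (U : set E) (f : E -> R) : Prop :=
  {within U, continuous f} /\
  if k is k'.+1 then
    forall i : 'I_n.+1,
      (forall z, U z ->
         derivable_in (W := R^o) halfspace f (delta_mx 0 i) z)
      /\ Ck_on k' U (partial i f)
  else True.

Definition smooth_on (U : set E) (f : E -> R) : Prop :=
  forall k, Ck_on k U f.

Definition jac (F : E -> E) (z : E) : 'M[R]_n.+1 :=
  \matrix_(k, i) partial i (fun y => F y 0 k) z.

(* [G z] is the Gram matrix of the metric in the coordinates at [z]. *)
Variable G : E -> 'M[R]_n.+1.

Definition coord_grad (u : E -> R) (z : E) : E :=
  \row_i \sum_j invmx (G z) i j * partial j u z.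

Definition coord_sqnorm (V : E -> E) (z : E) : R :=
  \sum_i \sum_j G z i j * V z 0 i * V z 0 j.

Definition coord_cosqnorm (u : E -> R) (z : E) : R :=
  \sum_i \sum_j invmx (G z) i j * partial i u z * partial j u z.

Definition coord_div (V : E -> E) (z : E) : R :=
  (Num.sqrt (\det (G z)))^-1 *
  \sum_i partial i (fun y => Num.sqrt (\det (G y)) * V y 0 i) z.

Definition coord_laplacian (u : E -> R) : E -> R := coord_div (coord_grad u).

Definition christoffel (k i j : 'I_n.+1) (z : E) : R :=
  2^-1 * \sum_l invmx (G z) k l *
    (partial i (fun y => G y j l) z + partial j (fun y => G y i l) z
     - partial l (fun y => G y i j) z).

Definition coord_ricci (j k : 'I_n.+1) (z : E) : R :=
  \sum_i (partial i (christoffel i j k) z - partial j (christoffel i i k) z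
    + \sum_m (christoffel i i m z * christoffel m j k z
              - christoffel i j m z * christoffel m i k z)).

(* Sign convention: positive on round spheres. *)
Definition coord_scal (z : E) : R :=
  \sum_j \sum_k invmx (G z) j k * coord_ricci j k z.

End HalfSpace.

(* A chart is a map [cmap] on [cdom] to the half-space of dimension n+1 with
   inverse [cinv] on its image; the values elsewhere are irrelevant. *)
Record chart (R : realType) (n : nat) (T : Type) := Chart {
  cdom : set T;
  cmap : T -> 'rV[R]_n.+1;
  cinv : 'rV[R]_n.+1 -> T }.

Definition smooth_map {R : realType} {m n : nat} {T1 T2 : topologicalType}
    (A1 : set (chart R m T1)) (A2 : set (chart R n T2))
    (D : set T1) (f : T1 -> T2) : Prop :=
  {within D, continuous f} /\
  forall c d, A1 c -> A2 d -> forall j : 'I_n.+1,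
    smooth_on (cmap c @` [set p | [/\ D p, cdom c p & cdom d (f p)]])
              (fun z => cmap d (f (cinv c z)) 0 j).

Definition diffeo_onto {R : realType} {m n : nat} {T1 T2 : topologicalType}
    (A1 : set (chart R m T1)) (A2 : set (chart R n T2))
    (D1 : set T1) (D2 : set T2) (f : T1 -> T2) : Prop :=
  f @` D1 = D2 /\ smooth_map A1 A2 D1 f /\
  exists f' : T2 -> T1,
    [/\ f' @` D2 = D1, {in D1, cancel f f'} & smooth_map A2 A1 D2 f'].

Section Manifold.
Variables (R : realType) (n : nat) (X : topologicalType).
Variable A : set (chart R n X).

Definition smooth_fun (U : set X) (f : X -> R) : Prop :=
  forall c, A c -> smooth_on (cmap c @` (U `&` cdom c)) (f \o cinv c).

Record smooth_atlas : Prop := SmoothAtlas {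
  atlas_dom_open : forall c, A c -> open (cdom c);
  atlas_image_open : forall c, A c ->
    exists V : set 'rV[R]_n.+1,
      open V /\ cmap c @` cdom c = V `&` @halfspace R n;
  atlas_mapK : forall c, A c -> {in cdom c, cancel (cmap c) (cinv c)};
  atlas_map_continuous : forall c, A c -> {within cdom c, continuous (cmap c)};
  atlas_inv_continuous : forall c, A c ->
    {within cmap c @` cdom c, continuous (cinv c)};
  atlas_cover : forall p : X, exists2 c, A c & cdom c p;
  atlas_compatible : smooth_map A A setT id }.

(* The dimension of the manifold is n+1. *)
Record compact_manifold : Prop := CompactManifold {
  manifold_atlas : smooth_atlas;
  manifold_hausdorff : hausdorff_space X;
  manifold_compact : compact [set: X] }.

Definition bd : set X :=
  [set p | exists c, [/\ A c, cdom c p & cmap c p 0 ord0 = 0]].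

(* [g c p] is the Gram matrix of the metric at the point [p] in the coordinate
   frame of the chart [c]. *)

Definition tensor2 := chart R n X -> X -> 'M[R]_n.+1.

Definition in_coords (g : tensor2) (c : chart R n X) (z : 'rV[R]_n.+1) :=
  g c (cinv c z).

Record riemannian (g : tensor2) : Prop := Riemannian {
  metric_sym : forall c p, A c -> cdom c p -> (g c p)^T = g c p;
  metric_pos : forall c p, A c -> cdom c p ->
    forall v : 'rV[R]_n.+1, v != 0 -> 0 < (v *m g c p *m v^T) 0 0;
  metric_smooth : forall c, A c -> forall i j,
    smooth_on (cmap c @` cdom c) (fun z => in_coords g c z i j);
  metric_change : forall c d p, A c -> A d -> cdom c p -> cdom d p ->
    let P := jac (cmap d \o cinv c) (cmap c p) in
    g c p = P^T *m g d p *m P }.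

Section Operators.
Variables (g : tensor2) (c : chart R n X).

Definition laplacian_in (f : X -> R) (p : X) : R :=
  coord_laplacian (in_coords g c) (f \o cinv c) (cmap c p).

Definition cosqnorm_in (f : X -> R) (p : X) : R :=
  coord_cosqnorm (in_coords g c) (f \o cinv c) (cmap c p).

Definition scal_in (p : X) : R := coord_scal (in_coords g c) (cmap c p).

Definition grad_in (f : X -> R) (p : X) : 'rV[R]_n.+1 :=
  coord_grad (in_coords g c) (f \o cinv c) (cmap c p).

Definition grad_sqnorm_in (f : X -> R) (p : X) : R :=
  coord_sqnorm (in_coords g c)
    (coord_grad (in_coords g c) (f \o cinv c)) (cmap c p).

End Operators.

Record boundary_defining (sigma : X -> R) : Prop := BoundaryDefining {
  bdf_smooth : smooth_fun setT sigma;
  bdf_zero : forall p, sigma p = 0 <-> bd p;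
  bdf_pos : forall p, ~ bd p -> 0 < sigma p;
  bdf_diff : forall c p, A c -> cdom c p -> bd p ->
    exists i, partial i (sigma \o cinv c) (cmap c p) != 0 }.

(* A function on [X] is equated with a metric invariant by requiring that it
   agrees at each point with its expression in every chart around the point;
   these expressions do not depend on the chart. *)
Definition is_J (g : tensor2) (J : X -> R) : Prop :=
  forall c p, A c -> cdom c p -> (2 * n)%:R * J p = scal_in g c p.

Definition is_rho (g : tensor2) (sigma J rho : X -> R) : Prop :=
  forall c p, A c -> cdom c p ->
    n.+1%:R * rho p = - laplacian_in g c sigma p - sigma p * J p.

(* The singular Yamabe condition to order n+1, with remainder [Rem] whose restriction
   to [bd] is the singular Yamabe obstruction. *)
Definition singular_yamabe (g : tensor2) (sigma rho Rem : X -> R) : Prop :=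
  exists W : set X, [/\ open W, bd `<=` W, smooth_fun W Rem &
    forall c p, A c -> W p -> cdom c p ->
      cosqnorm_in g c sigma p + 2 * sigma p * rho p
      = 1 + sigma p ^+ n.+1 * Rem p].

Definition collar (eps : R) : set (R * X) :=
  [set q | 0 <= q.1 < eps /\ bd q.2].

(* The smooth structure of [0, eps) x bd as a manifold with boundary: the normal
   coordinate, which vanishes on [bd], is replaced by [s]. *)
Definition set_normal (s : R) (z : 'rV[R]_n.+1) : 'rV[R]_n.+1 :=
  \row_j (if j == ord0 then s else z 0 j).

Definition collar_chart (eps : R) (c : chart R n X) : chart R n (R * X)%type :=
  Chart (collar eps `&` [set q | cdom c q.2])
        (fun q => set_normal q.1 (cmap c q.2))
        (fun z => (z 0 ord0, cinv c (set_normal 0 z))).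

Definition collar_atlas (eps : R) : set (chart R n (R * X)%type) :=
  [set collar_chart eps c | c in A].

(* [eta (s, x)] is the flow of grad sigma / |grad sigma|^2 started at [x] in
   the boundary. *)
Record adapted_coordinates (g : tensor2) (sigma : X -> R) (eps : R)
    (eta : R * X -> X) : Prop := AdaptedCoordinates {
  adapted_eps : 0 < eps;
  adapted_start : forall x, bd x -> eta (0, x) = x;
  adapted_flow : forall s x d, A d -> collar eps (s, x) ->
    cdom d (eta (s, x)) ->
    grad_sqnorm_in g d sigma (eta (s, x)) != 0 /\
    is_derive_in (V := R^o) halfline (fun t : R => cmap d (eta (t, x))) 1 s
      ((grad_sqnorm_in g d sigma (eta (s, x)))^-1 *:
         grad_in g d sigma (eta (s, x)));
  adapted_diffeo : exists O : set X, [/\ open O, bd `<=` O &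
    diffeo_onto (collar_atlas eps) A (collar eps) O eta] }.

(* Metrics on the boundary are given by n x n Gram matrices with respect to the
   last n coordinates of the charts of [X]. *)
Definition bd_tensor2 := chart R n X -> X -> 'M[R]_n.

Definition bd_metric (g : tensor2) : bd_tensor2 :=
  fun c x => \matrix_(i, j) g c x (lift ord0 i) (lift ord0 j).

(* Row i is the image of the i-th boundary coordinate vector of the chart [c]
   under the differential of [f : bd -> X] at [x], in the frame of [d]. *)
Definition bd_differential (f : X -> X) (c d : chart R n X) (x : X) :
  'M[R]_(n, n.+1) :=
  \matrix_(i, k)
    partial (lift ord0 i) (fun z => cmap d (f (cinv c z)) 0 k) (cmap c x).

(* [h s] is the pull-back of [g] by [x |-> eta (s, x)], i.e. the restriction of
   the pull-back of [g] by [eta] to the slice {s} x bd. *)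
Definition slice_metrics (g : tensor2) (eps : R) (eta : R * X -> X)
    (h : R -> bd_tensor2) : Prop :=
  forall s x c d, A c -> A d -> collar eps (s, x) ->
    cdom c x -> cdom d (eta (s, x)) ->
    let T := bd_differential (fun y => eta (s, y)) c d x in
    h s c x = T *m g d (eta (s, x)) *m T^T.

(* [v s x] is the ratio dvol_{h s} / dvol_{h} at [x], where the metric in the
   denominator is the one induced by [g] on [bd]. *)
Definition volume_ratio (g : tensor2) (eps : R) (h : R -> bd_tensor2)
    (v : R -> X -> R) : Prop :=
  forall s x c, A c -> collar eps (s, x) -> cdom c x ->
    v s x = Num.sqrt (\det (h s c x)) / Num.sqrt (\det (bd_metric g c x)).

End Manifold.

(* Main.v *)
Require Import Defs.
From HB Require Import structures.
From mathcomp Require Import all_boot all_order all_algebra.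
From mathcomp Require Import all_classical all_reals all_analysis.
From mathcomp Require Import perm ring lra.

Set Implicit Arguments.
Unset Strict Implicit.
Unset Printing Implicit Defensive.

Import Order.TTheory GRing.Theory Num.Theory.
Import numFieldNormedType.Exports.

Local Open Scope classical_set_scope.
Local Open Scope ring_scope.

(** The proof follows the flow line through [x] in a single chart [c] around [x].
    Read in that chart, the adapted coordinates are a smooth map [Psi] between
    relatively open subsets of the half-space, whose normal coordinate [s] is
    also the value of [sigma] at the image point ([sigma_adapted]). Write [a] for
    the squared length of [d sigma] along the flow, [w = v' / v] for the
    logarithmic derivative of the volume of the slices, and a prime for the
    derivative in [s].

    The geometric input is the formula [Delta sigma = a w + a' / 2]
    ([laplacian_log_vol']). With [Y = grad sigma / a] one has
    [Delta sigma = a div Y + a'], and [div Y] is the growth rate of the Riemannian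
    volume under the flow of [Y]. The Jacobian matrix of [Psi] satisfies the
    linearized flow equation because second derivatives commute, so its
    determinant grows at the rate of the Euclidean divergence ([det_jac_flow]);
    and the pulled back metric is [ds^2 / a + h_s], which relates this
    determinant to the volume of the slices ([det_slice_metric]).

    By definition of [rho] this gives [(n + 1) rho = - a w - a' / 2 - s J], while
    the singular Yamabe condition reads [a = 1 - 2 s rho + s^(n+1) R]. Eliminating
    [a] and taking [n] derivatives at [s = 0], the two terms with [n] derivatives
    of [rho] cancel, and the Leibniz rule yields the formula
    ([obstruction_expansion]), as [n C(n - 1, j - 1) = j C(n, j)].

    All this takes place up to the boundary, with one-sided normal derivatives.
    The calculus needed for it rests on one observation: a move along a
    coordinate axis from a point of the half-space in a positive direction stays
    in it, and between two points of a box one can change one coordinate at a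
    time. This gives a mean value theorem ([mvt_box]), hence the chain rule
    ([has_partial_comp]) and the symmetry of second derivatives ([partialC]). *)

(** * Partial derivatives on the half-space *)

#[local] Instance dirs_in_filter (R : realType) (V : normedModType R) (D : set V)
  (d z : V) : Filter (dirs_in D d z).
Proof. exact: within_filter. Qed.

Section HalfSpaceCalculus.
Variables (R : realType) (n : nat).
Local Notation E := 'rV[R]_n.+1.
Local Notation H := (@halfspace R n).
Local Notation e_ i := (delta_mx 0 i : E).

(** Relational form of [partial]: the rules of differentiation are limits of
    difference quotients, and the values of the total operator follow from them
    by uniqueness of limits. *)
Definition has_partial (i : 'I_n.+1) (f : E -> R) (z : E) (w : R) :=
  is_derive_in (W := R^o) H f (e_ i) z w.

Definition rel_open (U : set E) :=
  forall z, U z -> H z /\ \forall y \near z, H y -> U y.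

(** With two points, a box contains every point whose coordinates lie between
    theirs, so that one can move inside it one coordinate at a time. *)
Definition box (r : R) (z0 : E) : set E :=
  [set z | H z /\ forall i, `|z 0 i - z0 0 i| < r].

(** The coordinate vectors never point out of the half-space, so small positive
    steps stay in it even at a boundary point. Hence limits of difference
    quotients are unique up to the boundary. *)
Lemma dirs_in_proper i z : H z -> ProperFilter (dirs_in H (e_ i) z).
Proof.
move=> Hz; apply: Build_ProperFilter_ex => P.
rewrite /dirs_in; rewrite /within /= => /nbhs_ballP[r /= r0 rP].
have /rP : ball (0 : R) r (r / 2).
  by rewrite /ball /= sub0r normrN gtr0_norm ?divr_gt0// ltr_pdivrMr// ltr_pMr// ltr1n.
move=> /(_ _ _) h; exists (r/2); apply: h.
  by rewrite gt_eqF// divr_gt0.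
rewrite /halfspace /= !mxE addr_ge0// mulr_ge0 ?ler0n// ltW// divr_gt0//.
Qed.

Lemma nbhs_rowP (z : E) (P : set E) :
  (nbhs z P) <-> exists2 r : R, 0 < r & forall y : E, (forall i, `|y 0 i - z 0 i| < r) -> P y.
Proof.
split.
  move=> /nbhs_ballP[r /= r0 rP]; exists r => // y yr; apply: rP.
  split => // i j; rewrite (ord1 i) /ball /=.
  by rewrite distrC.
move=> [r r0 rP]; apply/nbhs_ballP; exists r => // y [_ yr]; apply: rP => i.
by have := yr 0 i; rewrite /ball /= distrC.
Qed.

Lemma box_rel_open r z0 : rel_open (box r z0).
Proof.
move=> z [Hz zr]; split => //.
have rz i : 0 < r - `|z 0 i - z0 0 i| by rewrite subr_gt0.
pose d := \big[Num.min/1]_i (r - `|z 0 i - z0 0 i|).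
have d0 : 0 < d by apply: lt_bigmin => // i _; exact: rz.
apply/nbhs_rowP; exists d => // y yd Hy; split => // i.
have := yd i.
have : d <= r - `|z 0 i - z0 0 i| by exact: bigmin_le_cond.
move=> h1 h2; rewrite -(subrKA (z 0 i)).
apply: le_lt_trans (ler_normD _ _) _.
by rewrite -ltrBrDr (lt_le_trans h2).
Qed.

Lemma cvg_line (z d : E) : (z + t *: d) @[t --> (0:R)] --> z.
Proof.
have h : z + t *: d @[t --> (0:R)] --> z + 0 *: d.
  by apply: cvgD; [exact: cvg_cst | apply: cvgZr_tmp; exact: cvg_id].
by rewrite scale0r addr0 in h.
Qed.

Lemma near_dirs_in (z : E) i (P : set E) :
  (\forall y \near z, H y -> P y) ->
  \forall t \near dirs_in H (e_ i) z, P (z + t *: e_ i).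
Proof.
move=> hP.
have h : \forall t \near (0:R), H (z + t *: e_ i) -> P (z + t *: e_ i).
  by have /(_ _ hP) := @cvg_line z (e_ i).
rewrite /dirs_in /prop_near1 /within /=.
have {}h := nbhs_dnbhs h.
by apply: filterS h => t.
Qed.

Lemma near_dirs_in_neq0 i z : \forall t \near dirs_in H (e_ i) z, t != 0.
Proof.
rewrite /dirs_in; apply: cvg_within.
by rewrite /dnbhs /prop_near1 /within /=; apply: nearW.
Qed.

Lemma partialE i f z w : H z -> has_partial i f z w -> partial i f z = w.
Proof.
move=> Hz h; have := dirs_in_proper i Hz => ?.
exact: cvg_lim.
Qed.

Lemma derivable_inP i f z :
  derivable_in (W := R^o) H f (e_ i) z <-> has_partial i f z (partial i f z).
Proof. by split => [h|h]; [exact: h|apply/cvg_ex; exists (partial i f z)]. Qed.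

Lemma has_partial_eq i f g z w : (\forall y \near z, H y -> f y = g y) -> H z ->
  has_partial i f z w -> has_partial i g z w.
Proof.
move=> fg Hz; rewrite /has_partial /is_derive_in.
have fgz : f z = g z by exact: (nbhs_singleton fg).
apply: cvg_trans; apply: near_eq_cvg.
have := @near_dirs_in z i _ fg.
by apply: filterS => t ht; rewrite /diffq fgz ht.
Qed.

Lemma partial_eq i f g z : (\forall y \near z, H y -> f y = g y) -> H z ->
  partial i f z = partial i g z.
Proof.
move=> fg Hz; rewrite /partial /derive_in.
have fgz : f z = g z by exact: (nbhs_singleton fg).
have gf : (\forall y \near z, H y -> g y = f y).
  by apply: filterS fg => y h Hy; rewrite h.
congr (lim _); apply/seteqP; split; apply: near_eq_cvg.
  have := @near_dirs_in z i _ gf.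
  by apply: filterS => t ht; rewrite /diffq fgz ht.
have := @near_dirs_in z i _ fg.
by apply: filterS => t ht; rewrite /diffq fgz ht.
Qed.

Lemma has_partialP i f z w : has_partial i f z w <->
  (t^-1 * (f (z + t *: e_ i) - f z) : R) @[t --> dirs_in H (e_ i) z] --> w.
Proof. by []. Qed.

(** Continuity along the coordinate line is all that the product, quotient and
    square-root rules require. *)
Lemma has_partial_continuous i f z w : has_partial i f z w ->
  f (z + t *: e_ i) @[t --> dirs_in H (e_ i) z] --> f z.
Proof.
move=> /has_partialP h.
have t0 : t @[t --> dirs_in H (e_ i) z] --> (0 : R).
  move=> P /= hP; rewrite /dirs_in /within /=.
  by apply: nbhs_dnbhs; apply: filterS hP.
generalize (cvgD (F := dirs_in H (e_ i) z) (cvgM t0 h) (cvg_cst (f z) (F := dirs_in H (e_ i) z))).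
rewrite mul0r add0r; apply: cvg_trans; apply: near_eq_cvg.
apply: filterS (near_dirs_in_neq0 i z) => t t1 /=.
by rewrite fctE /= mulrA divff// mul1r subrK.
Qed.

Lemma has_partial_cst i (c : R) z : has_partial i (fun=> c) z 0.
Proof.
apply/has_partialP; generalize (cvg_cst (0 : R) (F := dirs_in H (e_ i) z)).
by apply: cvg_trans; apply: near_eq_cvg; apply: nearW => t /=; rewrite subrr mulr0.
Qed.

Lemma has_partialD i f g z a b : has_partial i f z a -> has_partial i g z b ->
  has_partial i (fun y => f y + g y) z (a + b).
Proof.
move=> /has_partialP hf /has_partialP hg; apply/has_partialP.
generalize (cvgD (F := dirs_in H (e_ i) z) hf hg); apply: cvg_trans; apply: near_eq_cvg.
by apply: nearW => t /=; rewrite -mulrDr opprD addrACA.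
Qed.

Lemma has_partialM i f g z a b : has_partial i f z a -> has_partial i g z b ->
  has_partial i (fun y => f y * g y) z (a * g z + f z * b).
Proof.
move=> hf hg; have cg := has_partial_continuous hg.
move: hf hg => /has_partialP hf /has_partialP hg; apply/has_partialP.
generalize (cvgD (F := dirs_in H (e_ i) z) (cvgM hf cg) (cvgM (cvg_cst (f z) (F := dirs_in H (e_ i) z)) hg)).
apply: cvg_trans; apply: near_eq_cvg.
by apply: nearW => t /=; rewrite !fctE /=; ring.
Qed.

Lemma has_partialB i f g z a b : H z -> has_partial i f z a -> has_partial i g z b ->
  has_partial i (fun y => f y - g y) z (a - b).
Proof.
move=> Hz hf hg.
have := has_partialD hf (has_partialM (has_partial_cst i (-1 : R) z) hg).
rewrite mul0r add0r mulN1r; apply: has_partial_eq => //.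
by apply: (filterE (F := nbhs z)) => y _; rewrite mulN1r.
Qed.

Lemma has_partialV i f z a : f z != 0 -> has_partial i f z a ->
  has_partial i (fun y => (f y)^-1) z (- (f z)^-1 * (f z)^-1 * a).
Proof.
move=> fz hf; have cf := has_partial_continuous hf.
move: hf => /has_partialP hf; apply/has_partialP.
have fn0 : \forall t \near dirs_in H (e_ i) z, f (z + t *: e_ i) != 0.
  exact: (cvgr_neq0 _ cf).
generalize (cvgM (F := dirs_in H (e_ i) z) (cvgM (cvgN (cvgV fz cf)) (cvg_cst (f z)^-1 (F := dirs_in H (e_ i) z))) hf).
apply: cvg_trans; apply: near_eq_cvg.
near=> t => /=.
have ft : f (z + t *: e_ i) != 0 by near: t.
have -> : (- unstable.inv_fun (fun s : R => f (z + s *: e_ i))) t = - (f (z + t *: e_ i))^-1 by [].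
by rewrite mulrCA; congr (_ * _); field; apply/andP.
Unshelve. all: by end_near. Qed.

Lemma has_partial_sqrt i f z a : 0 < f z -> has_partial i f z a ->
  has_partial i (fun y => Num.sqrt (f y)) z ((2 * Num.sqrt (f z))^-1 * a).
Proof.
move=> fz hf; have cf := has_partial_continuous hf.
move: hf => /has_partialP hf; apply/has_partialP.
have fn0 : \forall t \near dirs_in H (e_ i) z, 0 < f (z + t *: e_ i).
  exact: (cvgr_gt _ cf).
have cs : Num.sqrt (f (z + t *: e_ i)) @[t --> dirs_in H (e_ i) z] --> Num.sqrt (f z).
  by apply: (cvg_comp _ _ cf); exact: sqrt_continuous.
have s0 : 0 < Num.sqrt (f z) by rewrite sqrtr_gt0.
pose proof (cvgD (F := dirs_in H (e_ i) z) cs (cvg_cst (Num.sqrt (f z)) (F := dirs_in H (e_ i) z))) as h.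
have s20 : Num.sqrt (f z) + Num.sqrt (f z) != 0 by rewrite gt_eqF// addr_gt0.
generalize (cvgM (F := dirs_in H (e_ i) z) (cvgV s20 h) hf).
rewrite -mulr2n mulr_natl.
apply: cvg_trans; apply: near_eq_cvg.
near=> t => /=.
have ft : 0 < f (z + t *: e_ i) by near: t.
rewrite !fctE /= mulrCA; congr (_ * _).
rewrite -{2}(sqr_sqrtr (ltW ft)) -{2}(sqr_sqrtr (ltW fz)) subr_sqr.
rewrite mulrC -mulrA divff ?mulr1// gt_eqF// addr_gt0// sqrtr_gt0.
Unshelve. all: by end_near. Qed.

Lemma has_partial_coord i j z : has_partial i (fun y => y 0 j) z (i == j)%:R.
Proof.
apply/has_partialP.
generalize (cvg_cst ((i == j)%:R : R) (F := dirs_in H (e_ i) z)).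
apply: cvg_trans; apply: near_eq_cvg.
apply: filterS (near_dirs_in_neq0 i z) => t t1 /=.
rewrite !mxE eqxx /= addrAC subrr add0r mulrA mulVf// mul1r eq_sym//.
Qed.

End HalfSpaceCalculus.

(** * Algebra of smooth functions on the half-space *)

Section SmoothClass.
Variables (R : realType) (n : nat).
Local Notation E := 'rV[R]_n.+1.
Local Notation H := (@halfspace R n).
Local Notation e_ i := (delta_mx 0 i : E).
Implicit Types (f g : E -> R) (z : E) (k : nat).

Lemma within_continuousP (U : set E) f : {within U, continuous f} <->
  forall z, U z -> f y @[y --> within U (nbhs z)] --> f z.
Proof. exact: subspace_continuousP. Qed.

Lemma within_continuous_eq (U : set E) f g : (forall z, U z -> f z = g z) ->
  {within U, continuous f} -> {within U, continuous g}.
Proof.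
move=> fg; apply: subspace_eq_continuous => z; rewrite inE => /fg; exact.
Qed.

Lemma Ck_continuous k U f : Ck_on k U f -> {within U, continuous f}.
Proof. by case: k => [|k] []. Qed.

Lemma Ck_subset k (U V : set E) f : V `<=` U -> Ck_on k U f -> Ck_on k V f.
Proof.
move=> VU; elim: k f => [|k IH] f [cf h]; split => //; try exact: continuous_subspaceW cf.
move=> i; have [h1 h2] := h i; split; last exact: IH.
by move=> z /VU; exact: h1.
Qed.

Context {U : set E}.
Hypothesis oU : rel_open U.

Lemma CkSP k f : Ck_on k.+1 U f <-> {within U, continuous f} /\
  forall i, (forall z, U z -> has_partial i f z (partial i f z)) /\ Ck_on k U (partial i f).
Proof.
by split=> -[cf h]; split=> // i; have [h1 h2] := h i; split=> // z Uz;
  apply/derivable_inP; exact: h1.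
Qed.

Lemma Ck_eq k f g : (forall z, U z -> f z = g z) -> Ck_on k U f -> Ck_on k U g.
Proof.
elim: k f g => [|k IH] f g fg [cf h]; split => //; try exact: within_continuous_eq fg cf.
have near_fg z : U z -> \forall y \near z, H y -> f y = g y.
  move=> Uz; have [Hz] := oU Uz; apply: filterS => y UHy Hy; apply: fg; exact: UHy.
move=> i; have [h1 h2] := h i; split.
  move=> z Uz; have Hz := (oU Uz).1.
  apply/derivable_inP; rewrite -(partial_eq i (near_fg _ Uz) Hz).
  by apply: (has_partial_eq (near_fg _ Uz)) => //; apply/derivable_inP; exact: h1.
apply: IH h2 => z Uz; exact: partial_eq (near_fg _ Uz) (oU Uz).1.
Qed.

(** Closure properties go by induction on the order: a formula for the first
    derivatives on [U] has one order less, where the closure properties are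
    already known. *)
Lemma CkS_intro k f : {within U, continuous f} ->
  (forall i, exists2 df, (forall z, U z -> has_partial i f z (df z)) & Ck_on k U df) ->
  Ck_on k.+1 U f.
Proof.
move=> cf h; apply/CkSP; split=> // i; have [df h1 h2] := h i.
have dfE z : U z -> df z = partial i f z.
  by move=> Uz; rewrite (partialE (oU Uz).1 (h1 _ Uz)).
split; last exact: Ck_eq h2.
by move=> z Uz; rewrite -dfE//; exact: h1.
Qed.

Lemma CkW k f : Ck_on k.+1 U f -> Ck_on k U f.
Proof.
elim: k f => [|k IH] f; first by move=> /Ck_continuous cf; split.
move=> /CkSP[cf h]; apply/CkSP; split=> // i; have [h1 h2] := h i; split=> //.
exact: IH.
Qed.

Lemma Ck_le k m f : (k <= m)%N -> Ck_on m U f -> Ck_on k U f.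
Proof.
by move=> /subnK <-; elim: (m - k)%N => // j IH; rewrite addSn => /CkW; exact: IH.
Qed.

Lemma Ck_cst k (c : R) : Ck_on k U (fun=> c).
Proof.
elim: k c => [|k IH] c; first by split=> //; exact: cst_continuous.
apply: CkS_intro; first exact: cst_continuous.
by move=> i; exists (fun=> 0) => [z _|//]; exact: has_partial_cst.
Qed.

Lemma CkD k f g : Ck_on k U f -> Ck_on k U g -> Ck_on k U (fun z => f z + g z).
Proof.
elim: k f g => [|k IH] f g.
  by move=> [cf _] [cg _]; split=> //; exact: within_continuousD.
move=> /CkSP[cf hf] /CkSP[cg hg].
apply: CkS_intro; first exact: within_continuousD.
move=> i; have [hf1 hf2] := hf i; have [hg1 hg2] := hg i.
exists (fun z => partial i f z + partial i g z); last exact: IH.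
by move=> z Uz; apply: has_partialD; [exact: hf1|exact: hg1].
Qed.

Lemma within_continuousM f g : {within U, continuous f} -> {within U, continuous g} ->
  {within U, continuous (fun z => f z * g z)}.
Proof.
move=> /within_continuousP cf /within_continuousP cg; apply/within_continuousP => z Uz.
exact: cvgM (cf _ Uz) (cg _ Uz).
Qed.

Lemma CkM k f g : Ck_on k U f -> Ck_on k U g -> Ck_on k U (fun z => f z * g z).
Proof.
elim: k f g => [|k IH] f g.
  by move=> [cf _] [cg _]; split=> //; exact: within_continuousM.
move=> f1 g1; have f0 := CkW f1; have g0 := CkW g1.
move: f1 g1 => /CkSP[cf hf] /CkSP[cg hg].
apply: CkS_intro; first exact: within_continuousM.
move=> i; have [hf1 hf2] := hf i; have [hg1 hg2] := hg i.
exists (fun z => partial i f z * g z + f z * partial i g z); last first.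
  by apply: CkD; exact: IH.
by move=> z Uz; apply: has_partialM; [exact: hf1|exact: hg1].
Qed.

Lemma CkV k f : (forall z, U z -> f z != 0) -> Ck_on k U f ->
  Ck_on k U (fun z => (f z)^-1).
Proof.
move=> f0; have cV : {within U, continuous f} -> {within U, continuous (fun z => (f z)^-1)}.
  move=> /within_continuousP cf; apply/within_continuousP => z Uz.
  exact: cvgV (f0 _ Uz) (cf _ Uz).
elim: k => [|k IH]; first by move=> [cf _]; split=> //; exact: cV.
move=> f1; have {}IH := IH (CkW f1).
move: f1 => /CkSP[cf hf]; apply: CkS_intro; first exact: cV.
move=> i; have [hf1 hf2] := hf i.
exists (fun z => - (f z)^-1 * (f z)^-1 * partial i f z).
  by move=> z Uz; apply: has_partialV; [exact: f0|exact: hf1].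
apply: CkM => //; apply: CkM => //.
apply: (@Ck_eq _ (fun z => -1 * (f z)^-1)); first by move=> z _; rewrite mulN1r.
by apply: CkM => //; exact: Ck_cst.
Qed.

Lemma Ck_sqrt k f : (forall z, U z -> 0 < f z) -> Ck_on k U f ->
  Ck_on k U (fun z => Num.sqrt (f z)).
Proof.
move=> f0; have cS : {within U, continuous f} -> {within U, continuous (fun z => Num.sqrt (f z))}.
  move=> /within_continuousP cf; apply/within_continuousP => z Uz.
  by apply: (cvg_comp _ _ (cf _ Uz)); exact: sqrt_continuous.
elim: k => [|k IH]; first by move=> [cf _]; split=> //; exact: cS.
move=> f1; have {}IH := IH (CkW f1).
move: f1 => /CkSP[cf hf]; apply: CkS_intro; first exact: cS.
move=> i; have [hf1 hf2] := hf i.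
exists (fun z => (2 * Num.sqrt (f z))^-1 * partial i f z).
  by move=> z Uz; apply: has_partial_sqrt; [exact: f0|exact: hf1].
apply: CkM => //; apply: CkV.
  by move=> z Uz; rewrite mulf_neq0// gt_eqF// sqrtr_gt0 f0.
by apply: CkM => //; exact: Ck_cst.
Qed.

Lemma Ck_coord k j : Ck_on k U (fun z => z 0 j).
Proof.
have cc : {within U, continuous (fun z : E => z 0 j)}.
  by apply: continuous_subspaceT => z; exact: coord_continuous.
case: k => [|k]; first by split.
apply: CkS_intro => // i; exists (fun=> (i == j)%:R); last exact: Ck_cst.
by move=> z _; exact: has_partial_coord.
Qed.

Lemma smooth_subset (V : set E) f : V `<=` U -> smooth_on U f -> smooth_on V f.
Proof. by move=> VU sf k; exact: Ck_subset (sf k). Qed.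

Lemma smooth_eq f g : (forall z, U z -> f z = g z) -> smooth_on U f -> smooth_on U g.
Proof. by move=> fg sf k; exact: Ck_eq (sf k). Qed.

Lemma smooth_cst (c : R) : smooth_on U (fun=> c).
Proof. by move=> k; exact: Ck_cst. Qed.

Lemma smoothD f g : smooth_on U f -> smooth_on U g -> smooth_on U (fun z => f z + g z).
Proof. by move=> sf sg k; exact: CkD. Qed.

Lemma smoothM f g : smooth_on U f -> smooth_on U g -> smooth_on U (fun z => f z * g z).
Proof. by move=> sf sg k; exact: CkM. Qed.

Lemma smoothV f : (forall z, U z -> f z != 0) -> smooth_on U f ->
  smooth_on U (fun z => (f z)^-1).
Proof. by move=> f0 sf k; exact: CkV. Qed.

Lemma smooth_sqrt f : (forall z, U z -> 0 < f z) -> smooth_on U f ->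
  smooth_on U (fun z => Num.sqrt (f z)).
Proof. by move=> f0 sf k; exact: Ck_sqrt. Qed.

Lemma smooth_coord j : smooth_on U (fun z => z 0 j).
Proof. by move=> k; exact: Ck_coord. Qed.

Lemma smoothN f : smooth_on U f -> smooth_on U (fun z => - f z).
Proof.
move=> sf; apply: (@smooth_eq (fun z => -1 * f z)); first by move=> z _; rewrite mulN1r.
by apply: smoothM => //; exact: smooth_cst.
Qed.

Lemma smoothB f g : smooth_on U f -> smooth_on U g -> smooth_on U (fun z => f z - g z).
Proof. by move=> sf sg; apply: smoothD => //; exact: smoothN. Qed.

Lemma Ck_sum k (I : Type) (r : seq I) (F : I -> E -> R) :
  (forall i, Ck_on k U (F i)) -> Ck_on k U (fun z => \sum_(i <- r) F i z).
Proof.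
move=> sF; elim: r => [|a r IH].
  by apply: (@Ck_eq _ (fun=> 0)); [move=> z _; rewrite big_nil|exact: Ck_cst].
apply: (@Ck_eq _ (fun z => F a z + \sum_(i <- r) F i z)).
  by move=> z _; rewrite big_cons.
exact: CkD.
Qed.

Lemma smooth_sum (I : Type) (r : seq I) (F : I -> E -> R) :
  (forall i, smooth_on U (F i)) -> smooth_on U (fun z => \sum_(i <- r) F i z).
Proof. by move=> sF k; apply: Ck_sum => i; exact: sF. Qed.

Lemma smooth_prod (I : Type) (r : seq I) (F : I -> E -> R) :
  (forall i, smooth_on U (F i)) -> smooth_on U (fun z => \prod_(i <- r) F i z).
Proof.
move=> sF; elim: r => [|a r IH].
  by apply: (@smooth_eq (fun=> 1)); [move=> z _; rewrite big_nil|exact: smooth_cst].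
apply: (@smooth_eq (fun z => F a z * \prod_(i <- r) F i z)).
  by move=> z _; rewrite big_cons.
exact: smoothM.
Qed.

Lemma smoothX f k : smooth_on U f -> smooth_on U (fun z => f z ^+ k).
Proof.
move=> sf; elim: k => [|k IH].
  by apply: (@smooth_eq (fun=> 1)); [move=> z _; rewrite expr0|exact: smooth_cst].
by apply: (@smooth_eq (fun z => f z * f z ^+ k)); [move=> z _; rewrite exprS|exact: smoothM].
Qed.

Lemma smooth_partial i f : smooth_on U f -> smooth_on U (partial i f).
Proof. by move=> sf k; have /CkSP[_ /(_ i)[]] := sf k.+1. Qed.

Lemma smooth_has_partial i f z : smooth_on U f -> U z -> has_partial i f z (partial i f z).
Proof. by move=> sf Uz; have /CkSP[_ /(_ i)[h _]] := sf 1%N; exact: h. Qed.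

Lemma smooth_continuous f : smooth_on U f -> {within U, continuous f}.
Proof. by move=> sf; exact: Ck_continuous (sf 0%N). Qed.

Lemma smooth_det m (M : E -> 'M[R]_m) : (forall i j, smooth_on U (fun z => M z i j)) ->
  smooth_on U (fun z => \det (M z)).
Proof.
move=> sM; rewrite /determinant.
apply: smooth_sum => s; apply: smoothM; first exact: smooth_cst.
exact: smooth_prod.
Qed.

(** Cramer's rule. *)
Lemma smooth_invmx m (M : E -> 'M[R]_m) : (forall z, U z -> \det (M z) != 0) ->
  (forall i j, smooth_on U (fun z => M z i j)) ->
  forall i j, smooth_on U (fun z => invmx (M z) i j).
Proof.
move=> dM sM i j.
apply: (@smooth_eq (fun z => (\det (M z))^-1 * ((-1) ^+ (j + i) * \det (row' j (col' i (M z)))))).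
  by move=> z Uz; rewrite /invmx unitmxE unitfE dM// !mxE.
apply: smoothM; first by apply: smoothV => //; exact: smooth_det.
apply: smoothM; first exact: smooth_cst.
apply: smooth_det => k l.
by apply: (@smooth_eq (fun z => M z (lift j k) (lift i l))) => // z _; rewrite !mxE.
Qed.

End SmoothClass.

(** * Mean value theorem, chain rule and symmetry of second derivatives *)

Section MeanValue.
Variables (R : realType) (n : nat).
Local Notation E := 'rV[R]_n.+1.
Local Notation H := (@halfspace R n).
Local Notation e_ i := (delta_mx 0 i : E).
Implicit Types (f g : E -> R) (z : E).

(** A point strictly inside of the segment can be moved both ways without leaving
    the half-space, even when the segment starts on the boundary. So the
    one-sided derivative is the usual one there, and the classical mean value
    theorem applies. *)
Lemma mvt_line f i (p : E) (t : R) (df : R -> R) : H p -> 0 <= t ->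
  (forall s, 0 <= s <= t -> has_partial i f (p + s *: e_ i) (df s)) ->
  exists2 s, 0 <= s <= t & f (p + t *: e_ i) - f p = t * df s.
Proof.
move=> Hp t0 hdf.
have [->|tn0] := eqVneq t 0.
  by exists 0; rewrite ?lexx// scale0r addr0 subrr mul0r.
have tgt0 : 0 < t by rewrite lt_neqAle eq_sym tn0.
have Hps s : 0 <= s -> H (p + s *: e_ i).
  by move=> s0; rewrite /halfspace /= !mxE addr_ge0// mulr_ge0// ler0n.
pose phi s := f (p + s *: e_ i).
have dphi s : s \in `]0, t[ -> is_derive s 1 phi (df s).
  rewrite in_itv /= => /andP[s0 st].
  have h : (h^-1 *: ((phi \o shift s) (h *: (1:R)) - phi s) : R^o) @[h --> 0^'] -->
      (df s : R^o).
    have hd : has_partial i f (p + s *: e_ i) (df s) by apply: hdf; rewrite !ltW.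
    (* Both signs of small increments are admissible inside of the segment. *)
    have incl : 0^' `=>` dirs_in H (e_ i) (p + s *: e_ i).
      move=> P; rewrite /dirs_in /within /= => hP.
      have near0 : \forall y \near (0:R)^', H (p + s *: e_ i + y *: e_ i).
        apply: nbhs_dnbhs.
        near=> y; rewrite -addrA -scalerDl; apply: Hps.
        rewrite -lerBlDl sub0r ltW//; near: y.
        by apply: (cvgr_gt 0) => //; rewrite oppr_lt0.
      by apply: filterS2 hP near0 => y hy; exact: hy.
    have hd0 : diffq (W := R^o) f (e_ i) (p + s *: e_ i) y @[y --> 0^'] -->
        (df s : R^o).
      by apply: cvg_trans hd; exact: cvg_app incl.
    apply: cvg_trans hd0; apply: near_eq_cvg; apply: nearW => y /=.
    rewrite /diffq /phi /= /shift /= -addrA -scalerDl.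
    by rewrite [y *: (1:R)]mulr1 [s + y]addrC.
  apply: DeriveDef; last exact: cvg_lim h.
  by apply/cvg_ex; exists (df s).
have cphi : {within `[0, t], continuous phi}.
  apply/subspace_continuousP => s; rewrite /= in_itv /= => sI P hP.
  have := has_partial_continuous (hdf _ sI) hP.
  rewrite /dirs_in /within /= /dnbhs /within /= => h.
  have {}h : \forall y \near s, y - s != 0 -> H (p + s *: e_ i + (y - s) *: e_ i) ->
      P (f (p + s *: e_ i + (y - s) *: e_ i)).
    have ys : (y - s) @[y --> s] --> (0 : R).
      have h1 : (y - s) @[y --> s] --> (s - s : R) by apply: cvgB; [exact: cvg_id|exact: cvg_cst].
      by rewrite subrr in h1.
    by have := ys _ h.
  rewrite /prop_near1 /within /=.
  apply: filterS h => y; rewrite /= in_itv /= => hy /andP[y0 _].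
  have [->|ys] := eqVneq y s; first exact: nbhs_singleton hP.
  move: hy; rewrite -addrA -scalerDl [s + _]addrC subrK; apply; first by rewrite subr_eq0.
  by apply: Hps.
have [s sI h] := MVT tgt0 dphi cphi.
exists s; first by move: sI; rewrite in_itv /= => /andP[? ?]; rewrite !ltW.
by move: h; rewrite /phi scale0r addr0 subr0 mulrC.
Unshelve. all: by end_near. Qed.

Lemma box_convex r z0 z y : box r z0 z -> box r z0 y ->
  forall p : E, (forall j, Num.min (z 0 j) (y 0 j) <= p 0 j <= Num.max (z 0 j) (y 0 j)) ->
  box r z0 p.
Proof.
move=> [Hz zr] [Hy yr] p hp; split.
  have /andP[h _] := hp ord0; apply: le_trans h.
  by rewrite le_min; apply/andP; split.
move=> j; have := hp j; have := zr j; have := yr j.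
rewrite !ltr_distl => /andP[a b] /andP[c d] /andP[].
rewrite ge_min le_max => /orP[h1|h1] /orP[h2|h2]; apply/andP; split;
  by [apply: lt_le_trans h1|apply: le_lt_trans h2 _].
Qed.

(** Go from [z] to [y] by changing the coordinates one after the other and apply
    the mean value theorem to each step; all the corners met on the way lie
    between [z] and [y]. *)
Lemma mvt_box (r : R) (z0 : E) f (z y : E) :
  (forall i z, box r z0 z -> has_partial i f z (partial i f z)) ->
  box r z0 z -> box r z0 y ->
  exists2 xi : 'I_n.+1 -> E,
    (forall i j, Num.min (z 0 j) (y 0 j) <= xi i 0 j <= Num.max (z 0 j) (y 0 j)) &
    f y - f z = \sum_i partial i f (xi i) * (y 0 i - z 0 i).
Proof.
move=> df bz By.
(* The corner after the first m coordinates have been changed. *)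
pose p m : E := \row_j (if (j < m)%N then y 0 j else z 0 j).
have pb m j : Num.min (z 0 j) (y 0 j) <= p m 0 j <= Num.max (z 0 j) (y 0 j).
  by rewrite mxE; case: ifP => _; rewrite ge_min le_max !lexx ?orbT.
have Hp m : H (p m) by have [] := box_convex bz By (pb m).
have step (i : 'I_n.+1) : exists2 x : E,
    (forall j, Num.min (z 0 j) (y 0 j) <= x 0 j <= Num.max (z 0 j) (y 0 j)) &
    f (p i.+1) - f (p i) = partial i f x * (y 0 i - z 0 i).
  have pS : p i.+1 = p i + (y 0 i - z 0 i) *: e_ i.
    apply/rowP => j; rewrite !mxE eqxx /= ltnS.
    have [->|ji] := eqVneq j i; first by rewrite leqnn ltnn mulr1 addrC subrK.
    by rewrite leq_eqVlt (negbTE (ji : (j != i :> nat))) /= mulr0 addr0.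
  have [d0|d0] := leP 0 (y 0 i - z 0 i).
    have bnd s : 0 <= s <= y 0 i - z 0 i -> forall j,
        Num.min (z 0 j) (y 0 j) <= (p i + s *: e_ i) 0 j <= Num.max (z 0 j) (y 0 j).
      move=> /andP[s0 sd] j; have := pb i j; rewrite !mxE eqxx /=.
      have [->|ji] := eqVneq j i; last by rewrite mulr0 addr0.
      rewrite ltnn mulr1 => _; rewrite ge_min le_max; apply/andP; split.
        by rewrite lerDl s0.
      by rewrite -!lerBrDl sd orbT.
    have [|s sI e] := @mvt_line f i (p i) _ (fun s => partial i f (p i + s *: e_ i)) (Hp i) d0.
      by move=> s /bnd bs; apply: df; exact: box_convex bz By _ bs.
    exists (p i + s *: e_ i); first exact: bnd.
    by rewrite pS e mulrC.
  have pS' : p i = p i.+1 + (z 0 i - y 0 i) *: e_ i.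
    by rewrite pS -addrA -scalerDl addrA subrK subrr scale0r addr0.
  have d1 : 0 <= z 0 i - y 0 i by rewrite -opprB oppr_ge0 ltW.
  have bnd s : 0 <= s <= z 0 i - y 0 i -> forall j,
      Num.min (z 0 j) (y 0 j) <= (p i.+1 + s *: e_ i) 0 j <= Num.max (z 0 j) (y 0 j).
    move=> /andP[s0 sd] j; have := pb i.+1 j; rewrite !mxE eqxx /=.
    have [->|ji] := eqVneq j i; last by rewrite mulr0 addr0.
    rewrite ltnSn mulr1 => _; rewrite ge_min le_max; apply/andP; split.
      by rewrite lerDl s0 orbT.
    by rewrite -!lerBrDl sd.
  have [|s sI e] := @mvt_line f i (p i.+1) _ (fun s => partial i f (p i.+1 + s *: e_ i)) (Hp i.+1) d1.
    by move=> s /bnd bs; apply: df; exact: box_convex bz By _ bs.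
  exists (p i.+1 + s *: e_ i); first exact: bnd.
  by rewrite [p i in LHS]pS' -opprB e; ring.
have /choice[xi hxi] : forall i : 'I_n.+1, exists x : E,
    (forall j, Num.min (z 0 j) (y 0 j) <= x 0 j <= Num.max (z 0 j) (y 0 j)) /\
    f (p i.+1) - f (p i) = partial i f x * (y 0 i - z 0 i).
  by move=> i; have [x ? ?] := step i; exists x.
exists xi; first by move=> i; exact: (hxi i).1.
rewrite -(eq_bigr _ (fun i _ => (hxi i).2)).
rewrite -(big_mkord xpredT (fun i => f (p i.+1) - f (p i))) telescope_sumr//.
congr (f _ - f _); apply/rowP => j; rewrite !mxE ?ltn0//.
by rewrite ltn_ord.
Qed.



Lemma rel_open_box (U : set E) z : rel_open U -> U z ->
  exists2 r, 0 < r & box r z `<=` U.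
Proof.
move=> oU Uz; have [_ /nbhs_rowP[r r0 h]] := oU _ Uz.
by exists r => // y [Hy yr]; exact: h.
Qed.

Lemma box_center r z : H z -> 0 < r -> box r z z.
Proof. by move=> Hz r0; split=> // i; rewrite subrr normr0. Qed.

Lemma cvg_row (T : Type) (F : set_system T) {FF : Filter F} (Psi : T -> E) (l : E) :
  (forall j, (Psi y 0 j) @[y --> F] --> l 0 j) -> Psi y @[y --> F] --> l.
Proof.
move=> h P /nbhs_rowP[r r0 rP].
have : \forall y \near F, forall j, `|l 0 j - Psi y 0 j| < r.
  by apply: filter_forall => j; move/cvgrPdist_lt: (h j); exact.
by apply: filterS => y hy; apply: rP => j; rewrite distrC.
Qed.

Lemma cvg_row_within (T : Type) (F : set_system T) {FF : Filter F} (Psi : T -> E) (l : E)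
  (U : set E) :
  (forall j, (Psi y 0 j) @[y --> F] --> l 0 j) -> (\forall y \near F, U (Psi y)) ->
  Psi y @[y --> F] --> within U (nbhs l).
Proof.
move=> h UPsi P; rewrite /within /= => hP.
have {}hP : \forall y \near l, U y -> P y := hP.
have {}hP : \forall t \near F, U (Psi t) -> P (Psi t) := @cvg_row _ F FF Psi l h _ hP.
by apply: filterS2 UPsi hP => y Uy; exact.
Qed.

Lemma between_dist (a b x : R) : Num.min a b <= x <= Num.max a b -> `|a - x| <= `|a - b|.
Proof.
have [ab|ab] := leP a b => /andP[h1 h2].
  by rewrite ler0_norm ?subr_le0// ler0_norm ?subr_le0// !opprB lerB.
by rewrite ger0_norm ?subr_ge0// ger0_norm ?subr_ge0 ?(ltW ab)// lerB.
Qed.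

(** By [mvt_box] the increment of [f] is a combination of the increments of the
    components of [Psi], with partial derivatives of [f] at intermediate points
    as coefficients. The intermediate points tend to [Psi z], and the partial
    derivatives are continuous. *)
Lemma has_partial_comp (U : set E) f (Psi : E -> E) i z (P : 'I_n.+1 -> R) :
  rel_open U -> Ck_on 1 U f -> U (Psi z) ->
  (\forall t \near dirs_in H (e_ i) z, U (Psi (z + t *: e_ i))) ->
  (forall k, has_partial i (fun y => Psi y 0 k) z (P k)) ->
  has_partial i (f \o Psi) z (\sum_k partial k f (Psi z) * P k).
Proof.
move=> oU /CkSP[cf hf] Uz nU hP.
have [r r0 rU] := rel_open_box oU Uz.
have Hz1 := (oU _ Uz).1.
pose F := dirs_in H (e_ i) z.
have FF : Filter F by exact: dirs_in_filter.
pose G t := Psi (z + t *: e_ i).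
have cG j : G t 0 j @[t --> F] --> Psi z 0 j by exact: has_partial_continuous (hP j).
have nbox : \forall t \near F, box r (Psi z) (G t).
  have h : \forall y \near Psi z, H y -> box r (Psi z) y.
    by have [_] := box_rel_open (box_center Hz1 r0).
  have h1 : \forall t \near F, H (G t) -> box r (Psi z) (G t) := @cvg_row _ F FF G _ cG _ h.
  by apply: filterS2 h1 nU => t ht Ut; apply: ht; exact: (oU _ Ut).1.
have /choice[xi hxi] : forall t, exists xi : 'I_n.+1 -> E, box r (Psi z) (G t) ->
    (forall k j, Num.min (Psi z 0 j) (G t 0 j) <= xi k 0 j <= Num.max (Psi z 0 j) (G t 0 j)) /\
    f (G t) - f (Psi z) = \sum_k partial k f (xi k) * (G t 0 k - Psi z 0 k).
  move=> t; have [bt|nb] := pselect (box r (Psi z) (G t)); last by exists (fun=> 0).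
  have [|xi h1 h2] := @mvt_box r (Psi z) f _ _ _ (box_center Hz1 r0) bt; last by exists xi.
  by move=> k y By; have [h _] := hf k; apply: h; exact: rU.
have cxi k : partial k f (xi t k) @[t --> F] --> partial k f (Psi z).
  have cpk : {within U, continuous (partial k f)} by have [_ h] := hf k; exact: Ck_continuous h.
  move/within_continuousP: cpk => /(_ _ Uz); apply: cvg_comp.
  apply: cvg_row_within; last first.
    apply: filterS nbox => t bt; apply: rU.
    exact: box_convex (box_center Hz1 r0) bt _ ((hxi _ bt).1 k).
  move=> j; apply/cvgrPdist_lt => e e0.
  move/cvgrPdist_lt: (cG j) => /(_ _ e0); apply: filterS2 nbox => t bt.
  by apply: le_lt_trans; apply: between_dist; exact: (hxi _ bt).1.
apply/has_partialP.
have hsum : (\sum_k partial k f (xi t k) * (t^-1 * (G t 0 k - Psi z 0 k))) @[t --> F] -->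
    \sum_k partial k f (Psi z) * P k.
  apply: cvg_big => [|k _]; first exact: add_continuous.
  by apply: cvgM; [exact: cxi|exact: hP].
apply: cvg_trans hsum; apply: near_eq_cvg; apply: filterS nbox => t bt /=.
rewrite (hxi _ bt).2 big_distrr /=; apply: eq_bigr => k _.
by rewrite mulrCA.
Qed.

Lemma within_continuous_comp_row (U V : set E) f (Psi : E -> E) :
  {within V, continuous f} -> (forall z, U z -> V (Psi z)) ->
  (forall j, {within U, continuous (fun z => Psi z 0 j)}) ->
  {within U, continuous (f \o Psi)}.
Proof.
move=> /within_continuousP cf UV cPsi; apply/within_continuousP => z Uz.
apply: (cvg_comp _ _ _ (cf _ (UV _ Uz))); apply: cvg_row_within.
  by move=> j; move/within_continuousP: (cPsi j); exact.
by rewrite /prop_near1 /within /=; apply: nearW => y; exact: UV.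
Qed.

Lemma partial_comp (U V : set E) f (Psi : E -> E) i z :
  rel_open U -> rel_open V -> smooth_on V f -> (forall z, U z -> V (Psi z)) ->
  (forall j, smooth_on U (fun z => Psi z 0 j)) -> U z ->
  has_partial i (f \o Psi) z (\sum_k partial k f (Psi z) * partial i (fun y => Psi y 0 k) z).
Proof.
move=> oU oV sf UV sPsi Uz; apply: (has_partial_comp oV) => //.
- exact: UV.
- apply: (@near_dirs_in _ _ z i (fun y => V (Psi y))).
  by have [_] := oU _ Uz; apply: filterS => y h /h /UV.
- by move=> k; exact: smooth_has_partial (sPsi k) Uz.
Qed.

Lemma Ck_comp k (U V : set E) f (Psi : E -> E) : rel_open U -> rel_open V ->
  Ck_on k V f -> (forall z, U z -> V (Psi z)) ->
  (forall j, smooth_on U (fun z => Psi z 0 j)) -> Ck_on k U (f \o Psi).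
Proof.
move=> oU oV + UV sPsi.
have cP j := smooth_continuous (sPsi j).
elim: k f => [|k IH] f.
  by move=> [cf _]; split=> //; exact: within_continuous_comp_row cf UV cP.
move=> fk; have /CkSP[cf hf] := fk.
apply: (CkS_intro oU); first exact: within_continuous_comp_row cf UV cP.
move=> i; exists (fun z => \sum_l partial l f (Psi z) * partial i (fun y => Psi y 0 l) z).
  move=> z Uz; apply: (has_partial_comp oV).
  - apply: Ck_le fk; exact: ltn0Sn.
  - exact: UV.
  - apply: (@near_dirs_in _ _ z i (fun y => V (Psi y))).
    by have [_] := oU _ Uz; apply: filterS => y h /h /UV.
  - by move=> l; exact: smooth_has_partial (sPsi l) Uz.
apply: Ck_sum => // l; apply: CkM => //.
  by have [_ h] := hf l; exact: IH h.
exact: smooth_partial.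
Qed.

Lemma smooth_comp (U V : set E) f (Psi : E -> E) : rel_open U -> rel_open V ->
  smooth_on V f -> (forall z, U z -> V (Psi z)) ->
  (forall j, smooth_on U (fun z => Psi z 0 j)) -> smooth_on U (f \o Psi).
Proof. by move=> oU oV sf UV sPsi k; exact: Ck_comp (sf k) UV sPsi. Qed.

Lemma has_partial_shift i j f z c w : H z -> 0 <= c ->
  has_partial i f (z + c *: e_ j) w -> has_partial i (fun y => f (y + c *: e_ j)) z w.
Proof.
move=> Hz c0; apply: cvg_trans.
have incl : dirs_in H (e_ i) z `=>` dirs_in H (e_ i) (z + c *: e_ j).
  move=> P; rewrite /dirs_in /within /=; apply: filterS => t h Ht; apply: h.
  by move: Ht; rewrite /halfspace /= !mxE addrAC => Ht; rewrite addr_ge0// mulr_ge0// ler0n.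
apply: cvg_trans (cvg_app _ incl).
by apply: near_eq_cvg; apply: nearW => t; rewrite /diffq addrAC.
Qed.

(** The second difference of [f] over a small square equals its area times either
    mixed derivative at some point of the square. Positive increments suffice, so
    that the argument also holds at boundary points. *)
Lemma partialC (U : set E) f i j z : rel_open U -> Ck_on 2 U f -> U z ->
  partial i (partial j f) z = partial j (partial i f) z.
Proof.
have num (a b t r : R) : 0 < t -> a <= t -> b <= t -> t * 3 <= r -> a + b < r by lra.
have far (a b c d : R) : `|a - c| < `|a - b| / 2 -> `|b - d| < `|a - b| / 2 -> c = d -> False.
  move=> h1 h2 cd; have := ltrD h1 h2; rewrite cd -splitr ltNge => /negP; apply.
  by rewrite [`|b - d|]distrC -[a - b](subrKA d); exact: ler_normD.
have swap (a b c d : R) : a - b - (c - d) = a - c - (b - d) by ring.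
move=> oU /CkSP[cf hf] Uz.
have [r r0 rU] := rel_open_box oU Uz.
have Hz := (oU _ Uz).1.
have df k y : U y -> has_partial k f y (partial k f y) by have [h _] := hf k; exact: h.
have ddf k l y : U y -> has_partial k (partial l f) y (partial k (partial l f) y).
  by have [_ /CkSP[_ /(_ k)[h _]]] := hf l; exact: h.
have cddf k l : {within U, continuous (partial k (partial l f))}.
  by have [_ /CkSP[_ /(_ k)[_ ]]] := hf l; exact: Ck_continuous.
have offE k l s t m : (z + s *: e_ k + t *: e_ l) 0 m - z 0 m =
    s * (m == k)%:R + t * (m == l)%:R by rewrite !mxE eqxx /=; ring.
have inU k l s t : 0 <= s -> 0 <= t -> s + t < r -> U (z + s *: e_ k + t *: e_ l).
  move=> s0 t0 str; apply: rU; split.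
    by move: Hz; rewrite /halfspace /= !mxE => Hz; rewrite !addr_ge0// mulr_ge0// ler0n.
  move=> m; rewrite offE; apply: le_lt_trans str; rewrite ger0_norm ?addr_ge0 ?mulr_ge0 ?ler0n//.
  by apply: lerD; apply: ler_piMr => //; case: eqP.
(* The second difference, first in direction k and then in direction l. *)
have key k l t : 0 <= t -> t + t < r -> exists s s', [/\ 0 <= s <= t, 0 <= s' <= t &
    f (z + t *: e_ k + t *: e_ l) - f (z + t *: e_ k) - (f (z + t *: e_ l) - f z) =
    t * (t * partial l (partial k f) (z + s *: e_ k + s' *: e_ l))].
  move=> t0 tr.
  have H1 s : 0 <= s -> H (z + s *: e_ k).
    by move=> s0; move: Hz; rewrite /halfspace /= !mxE => Hz; rewrite addr_ge0// mulr_ge0// ler0n.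
  have [s|s /andP[s0 st] e1] := @mvt_line (fun y => f (y + t *: e_ l) - f y) k z t
     (fun s => partial k f (z + s *: e_ k + t *: e_ l) - partial k f (z + s *: e_ k)) Hz t0.
    move=> /andP[s0 st].
    have Us : U (z + s *: e_ k).
      by rewrite -[_ + _]addr0 -(scale0r (e_ l)); apply: inU => //; lra.
    apply: has_partialB; [exact: H1| |exact: df].
    by apply: has_partial_shift => //; [exact: H1|apply: df; apply: inU => //; lra].
  have [s' /andP[s'0 s't]|s' s'I e2] := @mvt_line (partial k f) l (z + s *: e_ k) t
     (fun s' => partial l (partial k f) (z + s *: e_ k + s' *: e_ l)) (H1 _ s0) t0.
    by apply: ddf; apply: inU => //; lra.
  by exists s, s'; split=> //; [apply/andP|rewrite e1 e2].
apply/eqP/negPn/negP => neq.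
pose A := partial i (partial j f) z; pose B := partial j (partial i f) z.
have AB : 0 < `|A - B| / 2 by rewrite divr_gt0// normr_gt0 subr_eq0.
have near_c k l e : 0 < e -> exists2 d, 0 < d & forall y, U y ->
    (forall m, `|y 0 m - z 0 m| < d) ->
    `|partial k (partial l f) z - partial k (partial l f) y| < e.
  move=> e0; have /within_continuousP/(_ _ Uz)/cvgrPdist_lt/(_ _ e0) := cddf k l.
  rewrite /prop_near1 /within /= => /nbhs_rowP[d d0 h].
  by exists d => // y Uy yd; exact: h.
have [d1 d10 h1] := near_c i j _ AB.
have [d2 d20 h2] := near_c j i _ AB.
(* A third of each bound, as a point of the square is within 2 t of z. *)
have [t [t0 tr td1 td2]] : exists t, [/\ 0 < t, t * 3 <= r, t * 3 <= d1 & t * 3 <= d2].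
  exists (Num.min r (Num.min d1 d2) / 3); rewrite divfK// divr_gt0 ?lt_min ?r0 ?d10//.
  by split; rewrite ?ge_min ?lexx ?orbT.
have tt : t + t < r by apply: num (lexx t) (lexx t) tr.
have [s [s' [/andP[s0 st] /andP[s'0 s't] e1]]] := key j i t (ltW t0) tt.
have [u [u' [/andP[u0 ut] /andP[u'0 u't] e2]]] := key i j t (ltW t0) tt.
have inbd k l a b d : 0 <= a <= t -> 0 <= b <= t -> t * 3 <= d -> forall m,
    `|(z + a *: e_ k + b *: e_ l) 0 m - z 0 m| < d.
  move=> /andP[a0 at_] /andP[b0 bt] td m; rewrite offE.
  rewrite ger0_norm ?addr_ge0 ?mulr_ge0 ?ler0n//.
  have h3 : a * (m == k)%:R <= t by apply: le_trans at_; apply: ler_piMr => //; case: eqP.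
  have h4 : b * (m == l)%:R <= t by apply: le_trans bt; apply: ler_piMr => //; case: eqP.
  exact: num t0 h3 h4 td.
have E1 : partial i (partial j f) (z + s *: e_ j + s' *: e_ i) =
    partial j (partial i f) (z + u *: e_ i + u' *: e_ j).
  apply: (mulfI (lt0r_neq0 t0)); apply: (mulfI (lt0r_neq0 t0)).
  apply: etrans (etrans _ e2); first exact: esym e1.
  have -> : z + t *: e_ j + t *: e_ i = z + t *: e_ i + t *: e_ j by rewrite addrAC.
  exact: swap.
have b1 := h1 _ (inU j i s s' s0 s'0 (num _ _ _ _ t0 st s't tr)) (inbd _ _ _ _ _ (introT andP (conj s0 st)) (introT andP (conj s'0 s't)) td1).
have b2 := h2 _ (inU i j u u' u0 u'0 (num _ _ _ _ t0 ut u't tr)) (inbd _ _ _ _ _ (introT andP (conj u0 ut)) (introT andP (conj u'0 u't)) td2).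
exact: far b1 b2 E1.
Qed.

End MeanValue.

(** * Iterated normal derivatives and the expansion of the obstruction *)

Ltac smooth_tac := repeat first [ assumption | apply: smooth_cst | apply: smooth_coord |
  apply: smoothD | apply: smoothB | apply: smoothM | apply: smoothN | apply: smoothX |
  apply: smooth_partial ].

Section Iterates.
Variables (R : realType) (n : nat).
Local Notation E := 'rV[R]_n.+1.
Local Notation H := (@halfspace R n).
Local Notation e_ i := (delta_mx 0 i : E).
Implicit Types (f g : E -> R) (z : E).

(** A derivative on the half-line only depends on the germ of the function, and
    the admissible increments at [t] are those of the half-space at the
    corresponding point of the normal line. This reduces the whole theorem to
    iterated partial derivatives in the half-space. *)
Lemma dpos_line (F : E -> R) (f : R -> R) (z : E) (d : R) : z 0 ord0 = 0 ->
  (forall t, 0 <= t < d -> f t = F (z + t *: e_ ord0)) ->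
  forall k t, 0 <= t < d -> dpos k f t = iter k (partial ord0) F (z + t *: e_ ord0).
Proof.
move=> z00 + k; elim: k f F => [|k IH] f F fF t tI; first exact: fF.
rewrite /dpos !iterSr; apply: IH tI => {}t tI.
rewrite /derive_in /partial /derive_in.
have dE : dirs_in (V := R^o) halfline 1 t = dirs_in H (e_ ord0) (z + t *: e_ ord0).
  rewrite /dirs_in; apply: (f_equal (fun S => within S 0^')); apply/seteqP.
  by split => s; rewrite /halfline /halfspace /= !mxE !eqxx /= z00 add0r mulr1;
    rewrite -[s *: 1]/(s * 1) mulr1.
rewrite -dE.
have h : \forall s \near dirs_in (V := R^o) halfline 1 t,
    diffq (V := R^o) (W := R^o) f 1 t s =
    diffq (W := R^o) F (e_ ord0) (z + t *: e_ ord0) s.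
  rewrite /dirs_in /prop_near1 /within /=; apply: nbhs_dnbhs.
  have tl : \forall s \near (0:R), s < d - t.
    apply/nbhs_ballP; exists (d - t); first by rewrite /= subr_gt0; case/andP: tI.
    by move=> s; rewrite /ball /= sub0r normrN => /ltr_normlW.
  apply: filterS tl => s sd; rewrite /halfline /= -[s *: 1]/(s * 1) mulr1 => ts.
  have tsI : 0 <= t + s < d by rewrite ts -ltrBrDl.
  by rewrite /diffq -[s *: 1]/(s * 1) mulr1 (fF _ tsI) (fF _ tI) scalerDl addrA.
congr (lim _); apply/seteqP; split; apply: near_eq_cvg => //.
by apply: filterS h => s ->.
Qed.

Context {U : set E} (oU : rel_open U).

Lemma partial_eq_on i f g z : (forall y, U y -> f y = g y) -> U z ->
  partial i f z = partial i g z.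
Proof.
move=> fg Uz; have [Hz nU] := oU Uz; apply: partial_eq => //.
by apply: filterS nU => y UHy Hy; apply: fg; exact: UHy.
Qed.

Lemma iter_partial_eq_on i k f g z : (forall y, U y -> f y = g y) -> U z ->
  iter k (partial i) f z = iter k (partial i) g z.
Proof.
move=> fg Uz; elim: k f g fg z Uz => [|k IH] f g fg z Uz; first exact: fg.
by rewrite !iterSr; apply: IH => // y Uy; exact: partial_eq_on.
Qed.

Lemma smooth_iter i k f : smooth_on U f -> smooth_on U (iter k (partial i) f).
Proof. by move=> sf; elim: k => //= k IH; exact: smooth_partial. Qed.

Lemma partialD_on i f g z : smooth_on U f -> smooth_on U g -> U z ->
  partial i (fun y => f y + g y) z = partial i f z + partial i g z.
Proof.
move=> sf sg Uz; apply: partialE; first by have [] := oU Uz.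
by apply: has_partialD; exact: smooth_has_partial Uz.
Qed.

Lemma partialM_on i f g z : smooth_on U f -> smooth_on U g -> U z ->
  partial i (fun y => f y * g y) z = partial i f z * g z + f z * partial i g z.
Proof.
move=> sf sg Uz; apply: partialE; first by have [] := oU Uz.
by apply: has_partialM; exact: smooth_has_partial Uz.
Qed.

Lemma partial_cst i (c : R) z : H z -> partial i (fun=> c) z = 0.
Proof. by move=> Hz; apply: partialE => //; exact: has_partial_cst. Qed.

Lemma partialZ_on i c f z : smooth_on U f -> U z ->
  partial i (fun y => c * f y) z = c * partial i f z.
Proof.
move=> sf Uz; rewrite (partialM_on _ (smooth_cst oU c) sf Uz) partial_cst ?mul0r ?add0r//.
by have [] := oU Uz.
Qed.

Lemma iter_partialD i k f g z : smooth_on U f -> smooth_on U g -> U z ->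
  iter k (partial i) (fun y => f y + g y) z =
  iter k (partial i) f z + iter k (partial i) g z.
Proof.
move=> sf sg; elim: k z => //= k IH z Uz.
by rewrite (partial_eq_on i IH Uz) partialD_on//; exact: smooth_iter.
Qed.

Lemma iter_partialZ i k c f z : smooth_on U f -> U z ->
  iter k (partial i) (fun y => c * f y) z = c * iter k (partial i) f z.
Proof.
move=> sf; elim: k z => //= k IH z Uz.
by rewrite (partial_eq_on i IH Uz) partialZ_on//; exact: smooth_iter.
Qed.

Lemma iter_partial_sum i k (I : Type) (r : seq I) (F : I -> E -> R) z :
  (forall j, smooth_on U (F j)) -> U z ->
  iter k (partial i) (fun y => \sum_(j <- r) F j y) z =
  \sum_(j <- r) iter k (partial i) (F j) z.
Proof.
move=> sF Uz; elim: r => [|a r IH].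
  rewrite big_nil (iter_partial_eq_on _ _ (g := fun y => 0 * 0))//; last first.
    by move=> y _; rewrite big_nil mul0r.
  by rewrite iter_partialZ ?mul0r//; exact: smooth_cst.
rewrite big_cons -IH -iter_partialD//; last exact: smooth_sum.
by apply: iter_partial_eq_on => // y _; rewrite big_cons.
Qed.

Lemma leibniz i k f g z : smooth_on U f -> smooth_on U g -> U z ->
  iter k (partial i) (fun y => f y * g y) z =
  \sum_(j < k.+1) 'C(k, j)%:R * (iter j (partial i) f z * iter (k - j) (partial i) g z).
Proof.
move=> sf sg; elim: k z => [|k IH] z Uz.
  by rewrite big_ord1 /= bin0 mul1r.
rewrite iterS (partial_eq_on i IH Uz).
pose P j y := 'C(k, j)%:R * (iter j (partial i) f y * iter (k - j) (partial i) g y).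
have sP j : smooth_on U (P j).
  by apply: smoothM => //; [exact: smooth_cst|apply: smoothM => //; exact: smooth_iter].
rewrite -/(P) -[LHS]/(iter 1 (partial i) (fun y => \sum_(j < k.+1) P j y) z).
rewrite (@iter_partial_sum i 1 _ _ (fun j : 'I_k.+1 => P j))//=.
have dP (j : 'I_k.+1) : partial i (P j) z =
    'C(k, j)%:R * (iter j.+1 (partial i) f z * iter (k.+1 - j.+1) (partial i) g z)
    + 'C(k, j)%:R * (iter j (partial i) f z * iter (k.+1 - j) (partial i) g z).
  rewrite /P partialZ_on//; last by apply: smoothM => //; exact: smooth_iter.
  rewrite partialM_on//; try exact: smooth_iter.
  by rewrite mulrDr subSS subSn// -ltnS.
rewrite (eq_bigr _ (fun j _ => dP j)) big_split /=.
rewrite [in RHS]big_ord_recl /= [X in _ + X = _]big_ord_recl /=.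
rewrite !bin0 /bump /= [in LHS]addrCA; congr (_ + _).
under [in RHS]eq_bigr => j _ do rewrite binS natrD mulrDl.
rewrite [in RHS]big_split /= addrC; congr (_ + _).
rewrite [in RHS]big_ord_recr /= bin_small// mul0r addr0.
by apply: eq_bigr => j _; rewrite add1n.
Qed.

Lemma iter_partial_coordM k f z : smooth_on U f -> U z ->
  iter k (partial ord0) (fun y => y 0 ord0 * f y) z =
  z 0 ord0 * iter k (partial ord0) f z + k%:R * iter k.-1 (partial ord0) f z.
Proof.
move=> sf; elim: k z => [|k IH] z Uz; first by rewrite /= mul0r addr0.
rewrite iterS (partial_eq_on _ IH Uz).
have s0 := smooth_coord oU ord0.
rewrite partialD_on//; last 2 first.
- by apply: smoothM => //; exact: smooth_iter.
- by apply: smoothM; [|exact: smooth_cst|exact: smooth_iter].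
rewrite partialM_on//; last exact: smooth_iter.
rewrite partialZ_on//; last exact: smooth_iter.
have -> : partial ord0 (fun y : E => y 0 ord0) z = 1.
  by apply: partialE; [have [] := oU Uz|exact: has_partial_coord].
rewrite /= mul1r addrAC addrC; congr (_ + _).
by case: k {IH} => [|k] /=; rewrite ?mul0r ?addr0 ?mul1r// -[in RHS]natr1 mulrDl mul1r addrC.
Qed.

(** The Taylor expansion along the normal line: a factor of order larger than [k]
    is not seen by [k] derivatives at the boundary. *)
Lemma iter_partial_powM k j f z : smooth_on U f -> U z -> z 0 ord0 = 0 ->
  iter k (partial ord0) (fun y => y 0 ord0 ^+ (k + j) * f y) z =
  if j == 0%N then k`!%:R * f z else 0.
Proof.
move=> sf Uz z0; elim: k => [|k IH].
  rewrite add0n /= z0 expr0n; case: eqP => _; by rewrite ?mul1r ?mul0r.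
rewrite (iter_partial_eq_on _ _ (g := fun y => y 0 ord0 * (y 0 ord0 ^+ (k + j) * f y)))//; last first.
  by move=> y _; rewrite addSn exprS mulrA.
rewrite iter_partial_coordM//; last first.
  by apply: smoothM => //; apply: smoothX => //; exact: smooth_coord.
rewrite z0 mul0r add0r [k.+1.-1]/= IH; case: eqP => _; last by rewrite mulr0.
by rewrite mulrA -natrM.
Qed.

(** Here [x] and [X] stand for the normal coordinate and its [m]-th power, [r],
    [j], [q] for the values of [rho], [J], [Q], and [dr], [dq] for the normal
    derivatives of [rho] and [Q]. *)
Let solve_for_w (x X w r dr j q dq m : R) :
  (m + 1) * r = - ((1 + (- 2) * (x * r) + x * X * q) * w
    + 2^-1 * ((- 2) * (r + x * dr) + ((m + 1) * X * q + x * X * dq))) - x * j ->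
  w = - m * r + (x * dr + (2 * (x * (r * w)) + (-1 * (x * j)
    + (- (2^-1 * (m + 1)) * (X * q) + -1 * (x * X * (w * q + 2^-1 * dq)))))).
Proof.
move=> h; apply/eqP; rewrite -subr_eq0; apply/eqP.
move/eqP: h; rewrite -subr_eq0 => /eqP <-; field => //.
Qed.

Let collect_terms (k1 k2 f q s d1 d2 : R) : k2 * f * q = - 2 * (- k1 * d2 + (k1 * d2 + (2 * (k1 * s)
  + (-1 * (k1 * d1) + (- (2^-1 * k2) * (f * q) + -1 * 0))))) + 4 * (k1 * s) - 2 * k1 * d1.
Proof. by field. Qed.

(** Eliminating [a] from the two equations leaves
      [w = - m rho + s rho' + 2 s rho w - s J - (m + 1) / 2 s^m Q + O(s^(m+1))]
    with [s] the normal coordinate. Take [m] normal derivatives at [s = 0]. Since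
    the derivative of order [m] of [s rho'] is [m] times that of [rho], the terms
    [- m rho] and [s rho'] cancel, the term in [Q] contributes a multiple of
    [(m + 1)!], and the products with [s] lower the order by one. *)
Lemma obstruction_expansion m (a w rho J Q : E -> R) z0 : (1 <= m)%N ->
  smooth_on U a -> smooth_on U w -> smooth_on U rho -> smooth_on U J -> smooth_on U Q ->
  (forall z, U z -> a z + 2 * z 0 ord0 * rho z = 1 + z 0 ord0 ^+ m.+1 * Q z) ->
  (forall z, U z -> m.+1%:R * rho z =
     - (a z * w z + 2^-1 * partial ord0 a z) - z 0 ord0 * J z) ->
  U z0 -> z0 0 ord0 = 0 ->
  m.+1`!%:R * Q z0 = - 2 * iter m (partial ord0) w z0
    + 4 * (\sum_(1 <= j < m.+1) j%:R * 'C(m, j)%:R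
        * iter (j - 1) (partial ord0) rho z0 * iter (m - j) (partial ord0) w z0)
    - (2 * m)%:R * iter (m - 1) (partial ord0) J z0.
Proof.
move=> m1 sa sw srho sJ sQ SY lapl Uz z00.
have s0 := smooth_coord oU ord0.
have dcoord z : U z -> partial ord0 (fun y : E => y 0 ord0) z = 1.
  by move=> Uz'; apply: partialE; [have [] := oU Uz'|exact: has_partial_coord].
have aE z : U z -> a z = 1 + (- 2) * (z 0 ord0 * rho z) + z 0 ord0 ^+ m.+1 * Q z.
  by move=> Uz'; have := SY _ Uz' => h; rewrite addrAC -h; ring.
have dpow k z : U z -> partial ord0 (fun y : E => y 0 ord0 ^+ k.+1) z = k.+1%:R * z 0 ord0 ^+ k.
  elim: k z => [|k IH] z Uz'.
    by rewrite expr0 mulr1; under eq_fun do rewrite expr1; exact: dcoord.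
  under eq_fun do rewrite exprS.
  rewrite partialM_on//; last exact: smoothX.
  by rewrite dcoord// IH// mul1r mulrCA -exprS -[in RHS]natr1 mulrDl mul1r addrC.
have daE z : U z -> partial ord0 a z = (- 2) * (rho z + z 0 ord0 * partial ord0 rho z)
    + (m.+1%:R * z 0 ord0 ^+ m * Q z + z 0 ord0 ^+ m.+1 * partial ord0 Q z).
  move=> Uz'; rewrite (partial_eq_on _ aE Uz').
  rewrite partialD_on//; [|by smooth_tac|by smooth_tac].
  rewrite partialD_on//; [|by smooth_tac|by smooth_tac].
  rewrite partial_cst ?add0r; last by have [] := oU Uz'.
  rewrite partialZ_on//; last by smooth_tac.
  rewrite partialM_on// dcoord// mul1r.
  by rewrite partialM_on ?dpow//; smooth_tac.
pose Er z := w z * Q z + 2^-1 * partial ord0 Q z.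
have sEr : smooth_on U Er by smooth_tac.
have idE z : U z -> w z = (- m%:R) * rho z + (z 0 ord0 * partial ord0 rho z
   + (2 * (z 0 ord0 * (rho z * w z)) + ((-1) * (z 0 ord0 * J z)
   + ((- (2^-1 * m.+1%:R)) * (z 0 ord0 ^+ m * Q z) + (-1) * (z 0 ord0 ^+ m.+1 * Er z))))).
  by move=> Uz'; have := lapl _ Uz'; rewrite daE// aE// -natr1 !exprS /Er => /solve_for_w.
have := iter_partial_eq_on ord0 m idE Uz.
have sdrho := smooth_partial ord0 srho.
rewrite iter_partialD//; [|by smooth_tac|by smooth_tac].
rewrite iter_partialD//; [|by smooth_tac|by smooth_tac].
rewrite iter_partialD//; [|by smooth_tac|by smooth_tac].
rewrite iter_partialD//; [|by smooth_tac|by smooth_tac].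
rewrite iter_partialD//; [|by smooth_tac|by smooth_tac].
rewrite !iter_partialZ//; try by smooth_tac.
rewrite !iter_partial_coordM//; try by smooth_tac.
have := iter_partial_powM m 0 sQ Uz z00; rewrite addn0 eqxx => ->.
have := iter_partial_powM m 1 sEr Uz z00; rewrite addn1 => ->.
rewrite z00 !mul0r !add0r /=.
have [k mE] : exists k, m = k.+1 by exists m.-1; rewrite prednK.
rewrite mE [k.+1.-1]/= (leibniz _ k srho sw Uz) -iterSr.
rewrite big_add1 big_mkord [k.+2.-1]/= subn1 [k.+1.-1]/= => ->.
rewrite [X in _ + 4 * X - _](eq_bigr (fun j : 'I_k.+1 => k.+1%:R *
  ('C(k, j)%:R * (iter j (partial ord0) rho z0 * iter (k - j) (partial ord0) w z0)))); last first.
  move=> j _; rewrite subn1 /= subSS -!mulrA mulrA -natrM -mul_bin_diag /=.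
  by rewrite natrM !mulrA.
rewrite -big_distrr (factS k.+1) !natrM.
exact: collect_terms.
Qed.
End Iterates.

(** * Derivative of a determinant *)

Section DetDerivative.
Variables (R : realType) (n : nat).
Local Notation E := 'rV[R]_n.+1.

Lemma has_partial_sum i (I : Type) (r : seq I) (F : I -> E -> R) z (d : I -> R) :
  (forall k, has_partial i (F k) z (d k)) ->
  has_partial i (fun y => \sum_(k <- r) F k y) z (\sum_(k <- r) d k).
Proof.
move=> h; elim: r => [|a r IH].
  rewrite big_nil (_ : (fun _ => _) = fun=> 0); first exact: has_partial_cst.
  by apply/funext => y; rewrite big_nil.
rewrite big_cons (_ : (fun _ => _) = fun y => F a y + \sum_(k <- r) F k y).
  exact: has_partialD.
by apply/funext => y; rewrite big_cons.
Qed.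

Lemma has_partial_prod i (I : eqType) (r : seq I) (F : I -> E -> R) z (d : I -> R) :
  uniq r -> (forall k, has_partial i (F k) z (d k)) ->
  has_partial i (fun y => \prod_(k <- r) F k y) z
    (\sum_(k <- r) d k * \prod_(l <- r | l != k) F l z).
Proof.
move=> + h; elim: r => [_|a r IH /= /andP[ar ur]].
  rewrite big_nil (_ : (fun _ => _) = fun=> 1); first exact: has_partial_cst.
  by apply/funext => y; rewrite big_nil.
rewrite (_ : (fun _ => _) = fun y => F a y * \prod_(k <- r) F k y); last first.
  by apply/funext => y; rewrite big_cons.
have := has_partialM (h a) (IH ur); congr (has_partial _ _ _ _).
rewrite [in RHS]big_cons [in RHS]big_cons eqxx /=; congr (_ * _ + _).
  rewrite [in RHS]big_seq_cond [in LHS]big_seq; apply: eq_bigl => k.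
  by have [->|] := eqVneq k a; rewrite ?(negbTE ar) ?andbT.
rewrite big_distrr /=; apply: eq_big_seq => k kr.
rewrite big_cons ifT; first by rewrite mulrCA.
by apply: contraNneq ar => ->.
Qed.

(** Jacobi's formula. Differentiating the Leibniz formula replaces one row at a
    time by its derivative; expanding along that row brings in the cofactors. *)
Lemma has_partial_det i m (M : E -> 'M[R]_m) (dM : 'M[R]_m) z :
  (forall k l, has_partial i (fun y => M y k l) z (dM k l)) ->
  has_partial i (fun y => \det (M y)) z (\tr (dM *m \adj (M z))).
Proof.
move=> h; rewrite /determinant.
have := @has_partial_sum i _ (index_enum _) _ z _ (fun s : 'S_m =>
  has_partialM (has_partial_cst i ((-1) ^+ s : R) z)
    (has_partial_prod (index_enum_uniq 'I_m) (fun k => h k (s k)))).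
congr (has_partial _ _ _ _).
transitivity (\sum_(k < m) \sum_(s : 'S_m) (-1) ^+ s *
   \prod_l (if l == k then dM else M z) l (s l)).
  rewrite exchange_big /=; apply: eq_bigr => s _.
  rewrite mul0r add0r big_distrr /=; apply: eq_bigr => k _.
  rewrite [in RHS](bigD1 k) //= eqxx; congr (_ * (_ * _)).
  by apply: eq_bigr => l /negbTE ->.
rewrite /mxtrace; apply: eq_bigr => k _; rewrite mxE.
pose N := \matrix_(l < m, j < m) (if l == k then dM else M z) l j.
transitivity (\det N).
  by apply: eq_bigr => s _; congr (_ * _); apply: eq_bigr => l _; rewrite mxE.
rewrite (expand_det_row _ k); apply: eq_bigr => j _; rewrite !mxE eqxx; congr (_ * _).
rewrite /cofactor; congr (_ * \det _); apply/matrixP => a b; rewrite !mxE.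
by rewrite eq_sym (negbTE (neq_lift _ _)).
Qed.

(** Liouville's formula for solutions of a linear matrix equation [M' = B M]. *)
Lemma has_partial_det_mulmx i m (M : E -> 'M[R]_m) (B : 'M[R]_m) z :
  (forall k l, has_partial i (fun y => M y k l) z ((B *m M z) k l)) ->
  has_partial i (fun y => \det (M y)) z (\tr B * \det (M z)).
Proof.
move=> /has_partial_det; rewrite -mulmxA mul_mx_adj mul_mx_scalar.
by rewrite mxtraceZ mulrC.
Qed.

End DetDerivative.

(** * The Laplacian of a function along its gradient flow *)

(** On the segment from [M] to the identity all matrices are positive definite,
    hence invertible. The determinant is a polynomial along the segment; it has
    no root there and equals 1 at the end. *)
Lemma posdef_det_gt0 (R : realType) m (M : 'M[R]_m) :
  (forall v : 'rV[R]_m, v != 0 -> 0 < (v *m M *m v^T) 0 0) -> 0 < \det M.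
Proof.
move=> Mpos.
have det_neq0 (t : R) : 0 <= t <= 1 -> \det (M + t *: (1%:M - M)) != 0.
  move=> /andP[t0 t1]; apply/negP => /det0P[v v0 hv].
  have vv : 0 < (v *m v^T) 0 0.
    rewrite mxE; have [j vj] : exists j, v 0 j != 0.
      apply/existsP; apply: contraNT v0; rewrite negb_exists => /forallP h.
      by apply/eqP/rowP => j; rewrite mxE; apply/eqP; move: (h j); rewrite negbK.
    rewrite (bigD1 j) //= ltr_pwDl//; first by rewrite mxE -expr2 exprn_even_gt0.
    by apply: sumr_ge0 => k _; rewrite mxE -expr2 sqr_ge0.
  have : (v *m (M + t *: (1%:M - M)) *m v^T) 0 0 = 0 by rewrite hv mul0mx mxE.
  (* The form at t is the convex combination of the forms of M and of 1. *)
  have -> : M + t *: (1%:M - M) = (1 - t) *: M + t *: 1%:M.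
    by rewrite scalerBr scalerBl scale1r addrAC addrA.
  rewrite mulmxDr mulmxDl -!scalemxAr -!scalemxAl mulmx1 !mxE.
  have Mv := Mpos _ v0; move: Mv vv; rewrite !mxE.
  set b := \sum_(_ < _) _; set c := \sum_(_ < _) _ => b0 c0 bc.
  have [te|tn] := eqVneq t 0.
    by move: bc b0; rewrite te subr0 mul1r mul0r addr0 => ->; rewrite ltxx.
  have : 0 < (1 - t) * b + t * c.
    rewrite ltr_wpDl//; first by rewrite mulr_ge0 ?subr_ge0// ltW.
    by rewrite mulr_gt0// lt_neqAle eq_sym tn.
  by rewrite bc ltxx.
rewrite ltNge; apply/negP => M0.
pose q := \det (map_mx polyC M + 'X *: map_mx polyC (1%:M - M)).
have qE t : q.[t] = \det (M + t *: (1%:M - M)).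
  rewrite -[LHS]/(horner_eval t q) -det_map_mx; congr (\det _).
  by apply/matrixP => i j; rewrite !mxE /= /horner_eval !hornerE.
have [|t tI] := @poly_ivt R q 0 1 ler01.
  by rewrite !qE scale0r addr0 M0 scale1r addrC subrK det1 ler01.
by rewrite /root qE; apply/negP; exact: det_neq0.
Qed.

Section AdaptedQuantities.
Variables (R : realType) (n : nat).
Local Notation E := 'rV[R]_n.+1.
Variables (G : E -> 'M[R]_n.+1) (u : E -> R) (Psi : E -> E).
Local Notation asq := (coord_cosqnorm G u).

Definition flow_field (z : E) : E := (asq z)^-1 *: coord_grad G u z.

Definition div_flow z := \sum_i partial i (fun y => flow_field y 0 i) z.

Definition slice_frame (z : E) : 'M[R]_(n, n.+1) :=
  \matrix_(i, k) partial (lift ord0 i) (fun y => Psi y 0 k) z.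

(** The determinant of the slice metric, by [det_slice_metric]. This expression is
    used since its smoothness and positivity are visible, and since its factors
    can be differentiated along the flow. *)
Definition vol_sq z := asq (Psi z) * \det (jac Psi z) ^+ 2 * \det (G (Psi z)).

Definition log_vol' z := partial ord0 vol_sq z / (2 * vol_sq z).

End AdaptedQuantities.

Section CoordinateGeometry.
Variables (R : realType) (n : nat).
Local Notation E := 'rV[R]_n.+1.
Context {G : E -> 'M[R]_n.+1} {u : E -> R}.
Context {V : set E} (oV : rel_open V).
Hypothesis sG : forall i j, smooth_on V (fun z => G z i j).
Hypothesis su : smooth_on V u.
Hypothesis Gsym : forall z, V z -> (G z)^T = G z.
Hypothesis Gpos : forall z, V z -> forall v : E, v != 0 -> 0 < (v *m G z *m v^T) 0 0.
Local Notation asq := (coord_cosqnorm G u).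
Local Notation flow_field := (flow_field G u).
Local Notation div_flow := (div_flow G u).

Lemma detG_gt0 z : V z -> 0 < \det (G z).
Proof. by move=> /Gpos; exact: posdef_det_gt0. Qed.

Lemma G_unit z : V z -> G z \in unitmx.
Proof. by move=> /detG_gt0 h; rewrite unitmxE unitfE gt_eqF. Qed.

Lemma smooth_invG i j : smooth_on V (fun z => invmx (G z) i j).
Proof. by apply: smooth_invmx => // z /detG_gt0 h; rewrite gt_eqF. Qed.

Lemma smooth_detG : smooth_on V (fun z => \det (G z)).
Proof. exact: smooth_det. Qed.

Lemma smooth_asq : smooth_on V asq.
Proof.
apply: smooth_sum => // i; apply: smooth_sum => // j.
by have ? := smooth_invG i j; smooth_tac.
Qed.

Lemma smooth_grad i : smooth_on V (fun z => coord_grad G u z 0 i).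
Proof.
apply: (smooth_eq oV (f := fun z => \sum_j invmx (G z) i j * partial j u z)).
  by move=> z _; rewrite mxE.
by apply: smooth_sum => // j; have ? := smooth_invG i j; smooth_tac.
Qed.

Lemma smooth_sqrt_detG : smooth_on V (fun z => Num.sqrt (\det (G z))).
Proof. by apply: smooth_sqrt => //; [exact: detG_gt0|exact: smooth_detG]. Qed.

Lemma smooth_laplacian : smooth_on V (coord_laplacian G u).
Proof.
apply: smoothM => //.
  apply: smoothV => //; last exact: smooth_sqrt_detG.
  by move=> z /detG_gt0 h; rewrite gt_eqF// sqrtr_gt0.
apply: smooth_sum => // i; apply: smooth_partial.
by apply: smoothM => //; [exact: smooth_sqrt_detG|exact: smooth_grad].
Qed.

Lemma smooth_christoffel k i j : smooth_on V (christoffel G k i j).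
Proof.
apply: smoothM => //; first exact: smooth_cst.
apply: smooth_sum => // l; have ? := smooth_invG k l.
by have ? := sG j l; have ? := sG i l; have ? := sG i j; smooth_tac.
Qed.

Lemma smooth_scal : smooth_on V (coord_scal G).
Proof.
have sC := smooth_christoffel.
apply: smooth_sum => // j; apply: smooth_sum => // k; apply: smoothM => //.
  exact: smooth_invG.
apply: smooth_sum => // i; apply: smoothD => //.
  by have ? := sC i j k; have ? := sC i i k; smooth_tac.
apply: smooth_sum => // m.
have ? := sC i i m; have ? := sC m j k; have ? := sC i j m; have ? := sC m i k.
by smooth_tac.
Qed.

Lemma G_grad z i : V z -> \sum_j G z i j * coord_grad G u z 0 j = partial i u z.
Proof.
move=> Vz; pose du : 'cV[R]_n.+1 := \col_j partial j u z.
transitivity ((G z *m (invmx (G z) *m du)) i 0).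
  rewrite mxE; apply: eq_bigr => j _; congr (_ * _); rewrite !mxE.
  by apply: eq_bigr => k _; rewrite mxE.
by rewrite mulKVmx ?G_unit// mxE.
Qed.

(** The gradient is dual to the differential, so both have the same length. *)
Lemma sqnorm_grad z : V z -> coord_sqnorm G (coord_grad G u) z = asq z.
Proof.
move=> Vz; rewrite /coord_sqnorm /coord_cosqnorm; apply: eq_bigr => i _.
transitivity (coord_grad G u z 0 i * \sum_j G z i j * coord_grad G u z 0 j).
  by rewrite big_distrr /=; apply: eq_bigr => j _; rewrite mulrAC mulrC.
rewrite G_grad// mxE mulrC big_distrr /=; apply: eq_bigr => j _.
by rewrite mulrA [_ * invmx _ _ _]mulrC.
Qed.

Lemma asq_ge0 z : V z -> 0 <= asq z.
Proof.
move=> Vz; rewrite -sqnorm_grad//; set v := coord_grad G u z.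
have -> : coord_sqnorm G (coord_grad G u) z = (v *m G z *m v^T) 0 0.
  rewrite mxE; under [RHS]eq_bigr => j _ do rewrite mxE big_distrl.
  rewrite /= exchange_big; apply: eq_bigr => i _; apply: eq_bigr => j _ /=.
  by rewrite [v^T _ _]mxE -/v; ring.
have [->|v0] := eqVneq v 0; first by rewrite mul0mx mul0mx mxE.
exact/ltW/Gpos.
Qed.

Lemma du_grad z : \sum_i partial i u z * coord_grad G u z 0 i = asq z.
Proof.
apply: eq_bigr => i _; rewrite mxE big_distrr /=; apply: eq_bigr => j _.
by rewrite mulrA [_ * invmx _ _ _]mulrC.
Qed.

Lemma flow_fieldE z i : flow_field z 0 i = (asq z)^-1 * coord_grad G u z 0 i.
Proof. by rewrite [LHS]mxE. Qed.

Hypothesis asq_neq0 : forall z, V z -> asq z != 0.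

Lemma asq_gt0 z : V z -> 0 < asq z.
Proof. by move=> Vz; rewrite lt_neqAle eq_sym asq_neq0 ?asq_ge0. Qed.

Lemma smooth_flow_field i : smooth_on V (fun z => flow_field z 0 i).
Proof.
apply: (smooth_eq oV (f := fun z => (asq z)^-1 * coord_grad G u z 0 i)).
  by move=> z _; rewrite flow_fieldE.
apply: smoothM => //; last exact: smooth_grad.
by apply: smoothV => //; exact: smooth_asq.
Qed.

(** Substitute [grad u = |du|^2 Y] with [Y] the velocity field of the flow. The
    divergence of [Y] measures the growth of volumes under the flow, and the
    derivative of [|du|^2] along [Y] is what remains. *)
Lemma coord_laplacianE z : V z -> coord_laplacian G u z =
  asq z * (div_flow z
    + (\sum_i partial i (fun y => \det (G y)) z * flow_field z 0 i) / (2 * \det (G z)))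
  + \sum_i partial i asq z * flow_field z 0 i.
Proof.
move=> Vz; have Hz := (oV Vz).1.
have dG := detG_gt0 Vz.
set D := Num.sqrt (\det (G z)).
have D0 : 0 < D by rewrite sqrtr_gt0.
have DD : D * D = \det (G z) by rewrite -expr2 sqr_sqrtr// ltW.
rewrite /coord_laplacian /coord_div -/D.
have term i : partial i (fun y => Num.sqrt (\det (G y)) * coord_grad G u y 0 i) z =
   D * (asq z * partial i (fun y => flow_field y 0 i) z
    + asq z * (partial i (fun y => \det (G y)) z * flow_field z 0 i) / (2 * (D * D))
    + partial i asq z * flow_field z 0 i).
  have -> : partial i (fun y => Num.sqrt (\det (G y)) * coord_grad G u y 0 i) z =
     partial i (fun y => Num.sqrt (\det (G y)) * (asq y * flow_field y 0 i)) z.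
    apply: (partial_eq_on oV) => // y Vy; congr (_ * _).
    by rewrite flow_fieldE mulrA divff ?mul1r// asq_neq0.
  apply: partialE => //.
  have h1 := has_partial_sqrt dG (smooth_has_partial (i := i) smooth_detG Vz).
  have h2 := smooth_has_partial (i := i) smooth_asq Vz.
  have h3 := smooth_has_partial (i := i) (smooth_flow_field i) Vz.
  have := has_partialM h1 (has_partialM h2 h3).
  congr (has_partial _ _ _ _); rewrite -/D; field; exact: lt0r_neq0.
rewrite (eq_bigr _ (fun i _ => term i)) -big_distrr /= mulKf ?lt0r_neq0//.
rewrite !big_split /= -DD mulrDr; congr (_ + _ + _); first by rewrite /div_flow big_distrr.
by rewrite [RHS]mulrA big_distrr big_distrl.
Qed.

Context {Psi : E -> E}.
Local Notation slice_frame := (slice_frame Psi).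
Local Notation vol_sq := (vol_sq G u Psi).
Local Notation log_vol' := (log_vol' G u Psi).
Context {U : set E} (oU : rel_open U).
Hypothesis sPsi : forall k, smooth_on U (fun z => Psi z 0 k).
Hypothesis PsiV : forall z, U z -> V (Psi z).
Hypothesis Psi_flow : forall z k, U z ->
  partial ord0 (fun y => Psi y 0 k) z = flow_field (Psi z) 0 k.
Hypothesis Psi_u : forall z, U z -> u (Psi z) = z 0 ord0.

Lemma smooth_jac k i : smooth_on U (fun z => jac Psi z k i).
Proof.
apply: (smooth_eq oU (f := partial i (fun y => Psi y 0 k))).
  by move=> z _; rewrite mxE.
exact: smooth_partial.
Qed.

(** Differentiating the flow equation [d_0 Psi = Y o Psi] in the other variables
    and exchanging the derivatives shows that the Jacobian matrix [P] solves
    [d_0 P = (DY o Psi) P]; the trace of [DY] is the divergence of [Y]. *)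
Lemma det_jac_flow z : U z ->
  has_partial ord0 (fun y => \det (jac Psi y)) z (div_flow (Psi z) * \det (jac Psi z)).
Proof.
move=> Uz; have Hz := (oU Uz).1.
pose B := \matrix_(k, l) partial l (fun y => flow_field y 0 k) (Psi z).
have -> : div_flow (Psi z) = \tr B by apply: eq_bigr => i _; rewrite mxE.
apply: has_partial_det_mulmx => k i.
have -> : (B *m jac Psi z) k i = partial ord0 (fun y => jac Psi y k i) z.
  transitivity (partial ord0 (partial i (fun y => Psi y 0 k)) z); last first.
    by apply: (partial_eq_on oU) => // y _; rewrite mxE.
  rewrite (partialC ord0 i oU (sPsi k 2%N) Uz).
  rewrite (partial_eq_on oU _ (g := (fun y => flow_field y 0 k) \o Psi))//; last first.
    by move=> y Uy; rewrite Psi_flow.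
  rewrite (partialE Hz (partial_comp (i := i) oU oV (smooth_flow_field k) PsiV sPsi Uz)).
  by rewrite mxE; apply: eq_bigr => l _; rewrite !mxE.
exact: smooth_has_partial (smooth_jac k i) Uz.
Qed.

(** The pulled back metric [P^T G P] splits: [G Y = du / |du|^2], and
    [u o Psi] is the normal coordinate, so that its first row is
    [(1 / |du|^2, 0, ..., 0)]. Expanding its determinant along this row leaves
    the block of the slice. *)
Lemma det_slice_metric z : U z ->
  \det (slice_frame z *m G (Psi z) *m (slice_frame z)^T) =
  asq (Psi z) * \det (jac Psi z) ^+ 2 * \det (G (Psi z)).
Proof.
move=> Uz; have Vz := PsiV Uz; have Hz := (oU Uz).1.
set P := jac Psi z; set Gz := G (Psi z); set a := asq (Psi z).
pose Q := P^T *m Gz *m P.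
have Q0 i : Q ord0 i = (i == ord0)%:R / a.
  have PG l : (P^T *m Gz) ord0 l = a^-1 * partial l u (Psi z).
    rewrite mxE -(G_grad l Vz) big_distrr /=; apply: eq_bigr => k _.
    rewrite [P^T _ _]mxE [P _ _]mxE Psi_flow// flow_fieldE -/a -mulrA; congr (_ * _).
    by rewrite mulrC -[Gz](Gsym Vz) mxE.
  rewrite mxE; under eq_bigr => l _ do rewrite PG -mulrA.
  rewrite -big_distrr /= mulrC; congr (_ / _).
  have <- : partial i (u \o Psi) z = (i == ord0)%:R.
    rewrite (partial_eq_on oU _ (g := fun y => y 0 ord0))//.
    by apply: partialE => //; exact: has_partial_coord.
  rewrite (partialE Hz (partial_comp (i := i) oU oV su PsiV sPsi Uz)).
  by apply: eq_bigr => l _; rewrite mxE.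
have detQ : \det Q = \det P ^+ 2 * \det Gz.
  by rewrite /Q !det_mulmx det_tr mulrAC -expr2.
have -> : slice_frame z *m Gz *m (slice_frame z)^T = row' ord0 (col' ord0 Q).
  rewrite /Q; apply/matrixP => i j; rewrite !mxE; apply: eq_bigr => l _; rewrite !mxE.
  by congr (_ * _); apply: eq_bigr => k _; rewrite !mxE.
have : \det Q = a^-1 * \det (row' ord0 (col' ord0 Q)).
  rewrite (expand_det_row _ ord0) (bigD1 ord0) //= big1 ?addr0.
    by rewrite Q0 eqxx mul1r /cofactor addn0 expr0 mul1r.
  by move=> i /negbTE i0; rewrite Q0 i0 mul0r mul0r.
rewrite detQ => h.
by rewrite -mulrA h mulrA mulfV ?mul1r// asq_neq0.
Qed.

Lemma smooth_asq_Psi : smooth_on U (asq \o Psi).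
Proof. exact: smooth_comp smooth_asq PsiV sPsi. Qed.

Lemma smooth_vol_sq : smooth_on U vol_sq.
Proof.
apply: smoothM => //; last exact: smooth_comp smooth_detG PsiV sPsi.
apply: smoothM => //; first exact: smooth_asq_Psi.
by apply: smoothX => //; apply: smooth_det => // k i; exact: smooth_jac.
Qed.

Hypothesis jac_neq0 : forall z, U z -> \det (jac Psi z) != 0.

Lemma vol_sq_gt0 z : U z -> 0 < vol_sq z.
Proof.
move=> Uz; have Vz := PsiV Uz.
rewrite mulr_gt0 ?detG_gt0// mulr_gt0 ?asq_gt0// exprn_even_gt0//=; exact: jac_neq0.
Qed.

Lemma smooth_log_vol' : smooth_on U log_vol'.
Proof.
apply: smoothM => //; first exact: smooth_partial smooth_vol_sq.
apply: smoothV => //; first by move=> z /vol_sq_gt0 h; rewrite mulf_neq0// gt_eqF.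
by apply: smoothM => //; [exact: smooth_cst|exact: smooth_vol_sq].
Qed.

(** The Laplacian of the defining function in adapted coordinates: the divergence
    terms of [coord_laplacianE] are the logarithmic derivatives of the factors of
    [vol_sq], except for the factor [|du|^2], which accounts for the last term. *)
Lemma laplacian_log_vol' z : U z -> coord_laplacian G u (Psi z) =
  asq (Psi z) * log_vol' z + 2^-1 * partial ord0 (asq \o Psi) z.
Proof.
move=> Uz; have Vz := PsiV Uz; have Hz := (oU Uz).1.
have flowE (f : E -> R) : \sum_k partial k f (Psi z) * partial ord0 (fun y => Psi y 0 k) z =
    \sum_k partial k f (Psi z) * flow_field (Psi z) 0 k.
  by apply: eq_bigr => k _; rewrite Psi_flow.
have ha := partial_comp (i := ord0) oU oV smooth_asq PsiV sPsi Uz.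
have hg := partial_comp (i := ord0) oU oV smooth_detG PsiV sPsi Uz.
rewrite (partialE Hz ha) coord_laplacianE//.
move: ha hg; rewrite !flowE.
move: (\sum_k _ * _) (\sum_k _ * _) => al ga ha hg.
have hd := det_jac_flow Uz.
have hF := has_partialM (has_partialM ha (has_partialM hd hd)) hg.
rewrite /log_vol' (partialE Hz hF) /vol_sq /=.
have := asq_gt0 Vz; have := detG_gt0 Vz; have := jac_neq0 Uz.
move: (asq (Psi z)) (\det (G (Psi z))) (\det (jac Psi z)) (div_flow (Psi z)).
move=> a g d D d0 /lt0r_neq0 g0 /lt0r_neq0 a0.
by field; rewrite d0 g0 a0.
Qed.

End CoordinateGeometry.

(** * Charts of a manifold with boundary *)

Section RelOpenPreimages.
Variables (R : realType) (n : nat).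
Local Notation E := 'rV[R]_n.+1.
Local Notation H := (@halfspace R n).

Lemma rel_open_halfspaceI (V : set E) : open V -> rel_open (V `&` H).
Proof.
move=> oV z [Vz Hz]; split=> //.
have : nbhs z V by exact: open_nbhs_nbhs.
by apply: filterS => y Vy Hy.
Qed.

Lemma rel_open_preimage (U : set E) (T : topologicalType) (f : E -> T) (W : set T) :
  rel_open U -> {within U, continuous f} -> open W ->
  rel_open [set z | U z /\ W (f z)].
Proof.
move=> oU /subspace_continuousP cf oW z [Uz Wz]; have [Hz nU] := oU _ Uz; split=> //.
have : \forall y \near z, U y -> W (f y).
  by have /(_ W) := cf _ Uz; apply; exact: open_nbhs_nbhs.
by apply: filterS2 nU => y HU UW /HU Uy; split=> //; exact: UW.
Qed.

End RelOpenPreimages.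

Section Charts.
Variables (R : realType) (n : nat) (X : topologicalType) (A : set (chart R n X)).
Hypothesis hA : smooth_atlas A.
Variables (c : chart R n X) (Ac : A c).
Local Notation E := 'rV[R]_n.+1.
Local Notation D := (cmap c @` cdom c).

Lemma cmapK p : cdom c p -> cinv c (cmap c p) = p.
Proof. by move=> cp; apply: (atlas_mapK hA Ac); rewrite inE. Qed.

Lemma chart_imageP z : D z -> cdom c (cinv c z) /\ cmap c (cinv c z) = z.
Proof. by move=> [p cp <-]; rewrite cmapK. Qed.

Lemma chart_image_rel_open : rel_open D.
Proof.
have [V [oV ->]] := atlas_image_open hA Ac; exact: rel_open_halfspaceI.
Qed.

Lemma chart_image_open_rel_open W : open W -> rel_open (cmap c @` (W `&` cdom c)).
Proof.
move=> oW.
have -> : cmap c @` (W `&` cdom c) = [set z | D z /\ W (cinv c z)].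
  apply/seteqP; split=> z /=.
    by move=> [p [Wp cp] <-]; split; [exists p|rewrite cmapK].
  by move=> [[p cp <-]]; rewrite cmapK// => Wp; exists p.
apply: rel_open_preimage => //; first exact: chart_image_rel_open.
exact: (atlas_inv_continuous hA Ac).
Qed.

Variable sigma : X -> R.
Hypothesis hsigma : boundary_defining A sigma.

Lemma bdf_chart_smooth : smooth_on D (sigma \o cinv c).
Proof. by have := bdf_smooth hsigma Ac; rewrite setTI. Qed.

End Charts.

(** * Adapted coordinates in a chart *)

Section AdaptedCollar.
Variables (R : realType) (n : nat) (X : topologicalType) (A : set (chart R n X)).
Hypothesis hA : smooth_atlas A.
Variables (c : chart R n X) (Ac : A c).
Local Notation E := 'rV[R]_n.+1.
Local Notation H := (@halfspace R n).
Local Notation e_ i := (delta_mx 0 i : E).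
Local Notation D := (cmap c @` cdom c).
Variables (g : tensor2 R n X) (hg : riemannian A g).
Variables (sigma : X -> R) (hsigma : boundary_defining A sigma).
Variables (eps : R) (eta : R * X -> X) (heta : adapted_coordinates A g sigma eps eta).
Local Notation G := (in_coords g c).
Local Notation u := (sigma \o cinv c).
Local Notation asq := (coord_cosqnorm G u).

Definition bd_point (z : E) : X := cinv c (set_normal 0 z).
Definition collar_point (z : E) : R * X := (z 0 ord0, bd_point z).
(** The adapted coordinates read in the same chart [c] on both sides. One chart
    suffices because the flow starts at the given boundary point. *)
Definition adapted_map (z : E) : E := cmap c (eta (collar_point z)).
Local Notation Psi := adapted_map.

Lemma set_normalE s (z : E) j : set_normal s z 0 j = if j == ord0 then s else z 0 j.
Proof. by rewrite mxE. Qed.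

Lemma set_normal_id (z : E) : z 0 ord0 = 0 -> set_normal 0 z = z.
Proof. by move=> z0; apply/rowP => j; rewrite set_normalE; case: eqP => // ->. Qed.

Lemma set_normal_line (z : E) t : set_normal 0 (z + t *: e_ ord0) = set_normal 0 z.
Proof.
apply/rowP => j; rewrite !set_normalE !mxE eqxx /=.
by case: eqP => // _; rewrite mulr0 addr0.
Qed.

Lemma set_normal_continuous s : continuous (@set_normal R n s).
Proof.
move=> z; apply: (cvg_row (F := nbhs z)) => j.
under eq_cvg => y do rewrite set_normalE.
rewrite set_normalE; case: eqP => _; first exact: cvg_cst.
exact: coord_continuous.
Qed.

Lemma bd_pointP (z : E) : D (set_normal 0 z) ->
  [/\ bd A (bd_point z), cdom c (bd_point z) & cmap c (bd_point z) = set_normal 0 z].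
Proof.
move=> /(chart_imageP hA Ac)[h1 h2]; split => //.
by exists c; split => //; rewrite h2 set_normalE eqxx.
Qed.

Lemma sigma_bd p : bd A p -> sigma p = 0.
Proof. by move=> /(bdf_zero hsigma). Qed.

Let oD : rel_open D := chart_image_rel_open hA Ac.
Let su : smooth_on D u := bdf_chart_smooth Ac hsigma.

Lemma metric_chart_smooth i j : smooth_on D (fun z => G z i j).
Proof. exact: (metric_smooth hg). Qed.

Lemma metric_chart_sym z : D z -> (G z)^T = G z.
Proof. by move=> /(chart_imageP hA Ac)[cz _]; exact: (Defs.metric_sym hg Ac cz). Qed.

Lemma metric_chart_pos z : D z -> forall v : E, v != 0 -> 0 < (v *m G z *m v^T) 0 0.
Proof. by move=> /(chart_imageP hA Ac)[h _]; exact: (metric_pos hg Ac h). Qed.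

(** The continuity of [eta] is used on this set, to show that [adapted_dom], where
    moreover the flow has not left the chart, is relatively open. *)
Definition collar_dom : set E := [set z | [/\ H z, D (set_normal 0 z) & z 0 ord0 < eps]].

Lemma collar_dom_rel_open : rel_open collar_dom.
Proof.
have [V [oV DV]] := atlas_image_open hA Ac.
move=> z [Hz Dz zeps]; split=> //.
have : nbhs (set_normal 0 z) V by move: Dz; rewrite DV => -[Vz _]; exact: open_nbhs_nbhs.
move=> /(@set_normal_continuous 0 z) nV.
have /(_ [set t | t < eps]) := @coord_continuous R 1 n.+1 0 ord0 z.
move=> /(_ (open_nbhs_nbhs (conj (@open_lt R eps) zeps))) nE.
have {}nV : \forall y \near z, V (set_normal 0 y) := nV.
have {}nE : \forall y \near z, (y : E) 0 ord0 < eps := nE.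
apply: filterS2 nV nE => y Vy yeps Hy; split => //.
by rewrite DV; split=> //; rewrite /halfspace /= set_normalE eqxx.
Qed.

Lemma collar_point_collar z : collar_dom z -> collar A eps (collar_point z).
Proof.
by move=> [Hz Dz zeps]; split; [apply/andP|have [] := bd_pointP Dz].
Qed.

Lemma eta_collar_continuous : {within collar_dom, continuous (eta \o collar_point)}.
Proof.
have [W0 [_ _ [_ [[ceta _] _]]]] := adapted_diffeo heta.
apply/subspace_continuousP => z Uz.
have Cz := collar_point_collar Uz; have [Hz Dz zeps] := Uz.
move/subspace_continuousP: ceta => /(_ _ Cz); apply: cvg_comp.
have cpt : collar_point y @[y --> within collar_dom (nbhs z)] --> collar_point z.
  apply: (@cvg_pair _ _ _ (within collar_dom (nbhs z)) (nbhs (z 0 ord0)) (nbhs (bd_point z)) _ _ _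
    (fun y : E => y 0 ord0) bd_point).
    by apply: cvg_trans (@coord_continuous R 1 n.+1 0 ord0 z); apply: cvg_app; exact: cvg_within.
  have := atlas_inv_continuous hA Ac => /subspace_continuousP/(_ _ Dz); apply: cvg_comp.
  move=> P; rewrite /within /= => hP.
  have : \forall y \near z, D (set_normal 0 y) -> P (set_normal 0 y).
    exact: (@set_normal_continuous 0 z _ hP).
  by apply: filterS => y h [_ Dy _]; exact: h.
move=> P; rewrite /within /= => hP.
have : \forall y \near z, collar_dom y -> collar A eps (collar_point y) -> P (collar_point y).
  by have := cpt _ hP.
by apply: filterS => y h Uy; apply: h => //; exact: collar_point_collar.
Qed.

Definition adapted_dom : set E := [set z | collar_dom z /\ cdom c (eta (collar_point z))].

Lemma adapted_dom_rel_open : rel_open adapted_dom.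
Proof.
apply: (rel_open_preimage collar_dom_rel_open eta_collar_continuous).
exact: (atlas_dom_open hA Ac).
Qed.

Lemma adapted_map_in z : adapted_dom z -> D (Psi z).
Proof. by move=> [_ h]; exists (eta (collar_point z)). Qed.

Lemma adapted_mapK z : adapted_dom z -> cinv c (Psi z) = eta (collar_point z).
Proof. by move=> [_ h]; rewrite /Psi (cmapK hA Ac). Qed.

Lemma adapted_map_smooth k : smooth_on adapted_dom (fun z => Psi z 0 k).
Proof.
have [W0 [_ _ [_ [[_ seta] _]]]] := adapted_diffeo heta.
have Cc : collar_atlas A eps (collar_chart A eps c) by exists c.
apply: smooth_subset (seta _ _ Cc Ac k).
move=> z [Uz ce]; have Cz := collar_point_collar Uz.
have [Hz Dz zeps] := Uz; have [_ cb eb] := bd_pointP Dz.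
exists (collar_point z) => //=; rewrite eb.
by apply/rowP => j; rewrite !set_normalE; case: eqP => // ->.
Qed.

Lemma sqnorm_flow_neq0 z : adapted_dom z -> asq (Psi z) != 0.
Proof.
move=> Uz; have [Uz' ce] := Uz; have Cz := collar_point_collar Uz'.
have [+ _] := adapted_flow heta Ac Cz ce.
rewrite /grad_sqnorm_in (sqnorm_grad metric_chart_pos)//.
Qed.

Lemma adapted_map_flow z k : adapted_dom z ->
  has_partial ord0 (fun y => Psi y 0 k) z (flow_field G u (Psi z) 0 k).
Proof.
move=> Uz; have [Uz' ce] := Uz; have Cz := collar_point_collar Uz'.
have [_] := adapted_flow heta Ac Cz ce.
rewrite /grad_sqnorm_in (sqnorm_grad metric_chart_pos); last first.
  exact: adapted_map_in Uz.
rewrite /grad_in -/(Psi z) -/(flow_field G u (Psi z)) => h.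
have dE : dirs_in (V := R^o) halfline 1 (z 0 ord0) = dirs_in H (e_ ord0) z.
  rewrite /dirs_in; apply: (f_equal (fun S => within S 0^')); apply/seteqP.
  by split => s; rewrite /halfline /halfspace /= !mxE !eqxx /= mulr1 -[s *: 1]/(s * 1) mulr1.
have h1 : diffq (V := R^o) (fun t : R => cmap c (eta (t, bd_point z))) 1 (z 0 ord0) t 0 k
   @[t --> dirs_in H (e_ ord0) z] --> flow_field G u (Psi z) 0 k.
  rewrite -dE; have {}h : diffq (V := R^o) (fun t : R => cmap c (eta (t, bd_point z))) 1 (z 0 ord0) t
   @[t --> dirs_in (V := R^o) halfline 1 (z 0 ord0)] --> flow_field G u (Psi z) := h.
  apply: (cvg_comp _ (fun M : E => M 0 k) h); exact: coord_continuous.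
apply/has_partialP; apply: cvg_trans h1; apply: near_eq_cvg; apply: nearW => t /=.
rewrite /diffq !mxE /adapted_map /collar_point /bd_point set_normal_line !mxE !eqxx /= mulr1.
by rewrite -[t *: 1]/(t * 1) mulr1.
Qed.

Lemma du_flow z : adapted_dom z ->
  \sum_k partial k u (Psi z) * flow_field G u (Psi z) 0 k = 1.
Proof.
move=> Uz; have Dz := adapted_map_in Uz.
have -> : \sum_k partial k u (Psi z) * flow_field G u (Psi z) 0 k =
   (asq (Psi z))^-1 * \sum_k partial k u (Psi z) * coord_grad G u (Psi z) 0 k.
  by rewrite big_distrr /=; apply: eq_bigr => k _; rewrite flow_fieldE mulrCA.
by rewrite du_grad mulVf// sqnorm_flow_neq0.
Qed.

Lemma adapted_map_bd (z : E) : D z -> z 0 ord0 = 0 -> 0 < eps -> adapted_dom z /\ Psi z = z.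
Proof.
move=> Dz z0 eps0; have sz := set_normal_id z0.
have Dz0 : D (set_normal 0 z) by rewrite sz.
have [bz cz ez] := bd_pointP Dz0.
have ee : eta (collar_point z) = bd_point z.
  by rewrite /collar_point z0 (adapted_start heta).
split; last by rewrite /adapted_map ee ez sz.
split; last by rewrite ee.
by split=> //; [rewrite /halfspace /= z0|rewrite z0].
Qed.

(** Along the flow, [sigma] has derivative [du(grad u) / |du|^2 = 1], and it starts
    from 0 on the boundary. The box ensures that the flow line from the boundary
    to the given point stays in the chart. *)
Lemma sigma_adapted r (z0 : E) : z0 0 ord0 = 0 -> box r z0 `<=` adapted_dom ->
  forall z, box r z0 z -> u (Psi z) = z 0 ord0.
Proof.
move=> z00 bU z bz; pose p := set_normal 0 z.
have Uz := bU _ bz; have [[Hz Dz zeps] _] := Uz.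
have [Hz' zr] := bz.
have p0 : p 0 ord0 = 0 by rewrite set_normalE eqxx.
have Hp : H p by rewrite /halfspace /= p0.
have bp s : 0 <= s <= z 0 ord0 -> box r z0 (p + s *: e_ ord0).
  move=> /andP[s0 sz]; split; first by rewrite /halfspace /= !mxE eqxx /= add0r mulr1.
  move=> j; have := zr j; have := zr ord0; rewrite !mxE eqxx /= z00 subr0.
  case: (eqVneq j ord0) => [->|_]; last by rewrite mulr0 addr0.
  rewrite z00 subr0 add0r mulr1 => h _; apply: le_lt_trans h.
  by rewrite subr0 !ger0_norm.
have [s|s _] := @mvt_line _ _ (u \o Psi) ord0 p (z 0 ord0) (fun=> 1) Hp Hz'.
  move=> /bp/bU Us.
  have := @has_partial_comp _ _ _ u Psi ord0 _ (fun k => flow_field G u (Psi (p + s *: e_ ord0)) 0 k) oD (su 1) (adapted_map_in Us).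
  rewrite du_flow//; apply.
    apply: (@near_dirs_in _ _ _ ord0 (fun y => D (Psi y))).
    have [_] := adapted_dom_rel_open Us; apply: filterS => y h Hy.
    by apply: adapted_map_in; exact: h.
  by move=> k; exact: adapted_map_flow.
have -> : p + z 0 ord0 *: e_ ord0 = z.
  apply/rowP => j; rewrite !mxE eqxx /=.
  by case: eqP => [->|_]; rewrite ?mulr1 ?add0r ?mulr0 ?addr0.
have -> : (u \o Psi) p = 0.
  have [_ /= ->] := adapted_map_bd Dz p0 (adapted_eps heta).
  by apply: sigma_bd; have [] := bd_pointP Dz.
by rewrite subr0 mulr1.
Qed.

(** On the boundary hyperplane the adapted map is the identity, and its velocity is
    transversal to it: the tangential derivatives of [sigma] vanish there while
    its derivative along the flow is 1. *)
Lemma jac_adapted_bd (z : E) : D z -> z 0 ord0 = 0 -> \det (jac Psi z) != 0.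
Proof.
move=> Dz z0; have eps0 := adapted_eps heta.
have [Uz Pz] := adapted_map_bd Dz z0 eps0.
have Hz : H z := (oD Dz).1.
have lift0 (i : 'I_n) t : (z + t *: e_ (lift ord0 i)) 0 ord0 = 0.
  by rewrite !mxE (negbTE (neq_lift _ _)) andbF mulr0 addr0.
have nearD (i : 'I_n) : \forall t \near (0:R), D (z + t *: e_ (lift ord0 i)).
  have [_ nD] := oD Dz.
  have : \forall t \near (0:R), H (z + t *: e_ (lift ord0 i)) -> D (z + t *: e_ (lift ord0 i)).
    by have := @cvg_line _ _ z (e_ (lift ord0 i)) _ nD.
  apply: filterS => t; apply.
  by rewrite /halfspace /= lift0.
have nearE (i : 'I_n) (f : E -> R) (h : E -> R) w : (forall y, D y -> y 0 ord0 = 0 -> f y = h y) ->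
    has_partial (lift ord0 i) h z w -> has_partial (lift ord0 i) f z w.
  move=> fh; apply: cvg_trans; apply: near_eq_cvg.
  have := nbhs_dnbhs (nearD i).
  rewrite /dirs_in /prop_near1 /within /=; apply: filterS => t Dt _.
  by rewrite /diffq !fh.
have du0 (i : 'I_n) : partial (lift ord0 i) u z = 0.
  apply: partialE => //; apply: (nearE i u (fun=> 0)); last exact: has_partial_cst.
  move=> y Dy y0 /=; have [cy ey] := chart_imageP hA Ac Dy.
  by apply: sigma_bd; exists c; split=> //; rewrite ey.
have jl (i : 'I_n) k : jac Psi z k (lift ord0 i) = (lift ord0 i == k)%:R.
  rewrite mxE; apply: partialE => //.
  apply: (nearE i _ (fun y => y 0 k)); last exact: has_partial_coord.
  by move=> y Dy y0; rewrite (adapted_map_bd Dy y0 eps0).2.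
have j0 k : jac Psi z k ord0 = flow_field G u z 0 k.
  by rewrite mxE (partialE Hz (adapted_map_flow (k := k) Uz)) Pz.
have Y0 : flow_field G u z 0 ord0 != 0.
  have := du_flow Uz; rewrite Pz big_ord_recl big1 ?addr0; last first.
    by move=> i _; rewrite du0 mul0r.
  by apply: contra_eq_neq => ->; rewrite mulr0 eq_sym oner_neq0.
apply/negP => /det0P[v v0 hv].
have vl (i : 'I_n) : v 0 (lift ord0 i) = 0.
  have := congr1 (fun M : E => M 0 (lift ord0 i)) hv; rewrite !mxE.
  rewrite (bigD1 (lift ord0 i)) //= jl eqxx mulr1 big1 ?addr0// => k /negbTE ki.
  by rewrite jl eq_sym ki mulr0.
have v00 : v 0 ord0 = 0.
  have := congr1 (fun M : E => M 0 ord0) hv; rewrite !mxE big_ord_recl big1 ?addr0.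
    by rewrite j0 => /eqP; rewrite mulf_eq0 (negbTE Y0) orbF => /eqP.
  by move=> i _; rewrite vl mul0r.
move/eqP: v0; apply; apply/rowP => j; rewrite mxE.
by case: (unliftP ord0 j) => [k|] ->.
Qed.

Variables (h : R -> bd_tensor2 R n X) (hh : slice_metrics A g eps eta h).
Variables (v : R -> X -> R) (hv : volume_ratio A g eps h v).

(** The Gram matrix of the boundary is the restriction of a positive definite form. *)
Lemma bd_metric_det_gt0 p : cdom c p -> 0 < \det (bd_metric g c p).
Proof.
move=> cp; apply: posdef_det_gt0 => w w0.
pose S : 'M[R]_(n, n.+1) := rowsub (lift ord0) 1%:M.
have -> : bd_metric g c p = S *m g c p *m S^T.
  rewrite mul_rowsub_mx mul1mx; apply/matrixP => i j; rewrite !mxE.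
  rewrite (bigD1 (lift ord0 j)) //= !mxE eqxx mulr1 big1 ?addr0// => k kj.
  by rewrite !mxE eq_sym (negbTE kj) mulr0.
have wS0 : w *m S != 0.
  apply: contraNneq w0 => wS; apply/eqP/rowP => j; rewrite mxE.
  have := congr1 (fun M : E => M 0 (lift ord0 j)) wS; rewrite !mxE.
  rewrite (bigD1 j) //= !mxE eqxx mulr1 big1 ?addr0// => k kj.
  by rewrite !mxE (inj_eq lift_inj) (negbTE kj) mulr0.
have := metric_pos hg Ac cp wS0; rewrite trmx_mul.
by rewrite !mulmxA.
Qed.

Lemma box_line r (z0 : E) s : z0 0 ord0 = 0 -> 0 <= s < r -> box r z0 (z0 + s *: e_ ord0).
Proof.
move=> z00 /andP[s0 sr]; split; first by rewrite /halfspace /= !mxE z00 add0r mulr1.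
move=> j; rewrite !mxE eqxx /= [z0 0 j + _]addrC addrK.
by case: eqP => _; rewrite ?mulr1 ?mulr0 ?normr0 ?ger0_norm// (le_lt_trans s0).
Qed.

Lemma collar_point_line x s : cdom c x -> cmap c x 0 ord0 = 0 ->
  collar_point (cmap c x + s *: e_ ord0) = (s, x).
Proof.
move=> cx x0; rewrite /collar_point /bd_point set_normal_line set_normal_id//.
by rewrite (cmapK hA Ac)// !mxE x0 add0r mulr1.
Qed.

Definition regular_dom : set E := [set z | D z /\ asq z != 0].

Lemma regular_dom_rel_open : rel_open regular_dom.
Proof.
apply: (rel_open_preimage (W := [set t : R | t != 0]) oD); last exact: open_neq.
exact/smooth_continuous/(smooth_asq oD metric_chart_smooth su metric_chart_pos).
Qed.

Lemma adapted_map_regular z : adapted_dom z -> regular_dom (Psi z).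
Proof. by move=> Uz; split; [exact: adapted_map_in|exact: sqnorm_flow_neq0]. Qed.

(** The frame of the slice, computed on the boundary hyperplane, agrees with the
    tangential derivatives of the adapted map at height [s], since the map only
    sees the foot and the height of a point. *)
Lemma volume_ratio_adapted x r : cdom c x -> cmap c x 0 ord0 = 0 ->
  box r (cmap c x) `<=` adapted_dom -> forall s, 0 <= s < r ->
  v s x = (Num.sqrt (\det (bd_metric g c x)))^-1 *
          Num.sqrt (vol_sq G u Psi (cmap c x + s *: e_ ord0)).
Proof.
move=> cx x0 bU s sI; set z := cmap c x + _.
have bz : box r (cmap c x) z by exact: box_line.
have Uz := bU _ bz.
have cz : collar_point z = (s, x) by exact: collar_point_line.
have Cz : collar A eps (s, x) by rewrite -cz; exact: collar_point_collar Uz.1.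
have ce : cdom c (eta (s, x)) by rewrite -cz; exact: Uz.2.
rewrite (hv Ac Cz cx) mulrC; congr (_ * Num.sqrt _).
rewrite (hh Ac Ac Cz cx ce).
have -> : bd_differential (fun y => eta (s, y)) c c x = slice_frame Psi z.
  apply/matrixP => i k; rewrite !mxE /partial /derive_in.
  have dE : dirs_in H (e_ (lift ord0 i)) (cmap c x) = dirs_in H (e_ (lift ord0 i)) z.
    rewrite /dirs_in; apply: (f_equal (fun S => within S 0^')); apply/seteqP.
    have l0 t : (t * ((0 == 0 :> 'I_1) && (ord0 == lift ord0 i))%:R : R) = 0.
      by rewrite (negbTE (neq_lift _ _)) andbF mulr0.
    case/andP: sI => s0 _.
    by split => t; rewrite /halfspace /= !mxE l0 x0 !eqxx /= !add0r mulr1 addr0.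
  have qE : diffq (W := R^o) (fun y : E => cmap c (eta (s, cinv c y)) 0 k) (e_ (lift ord0 i))
      (cmap c x) = diffq (W := R^o) (fun y => Psi y 0 k) (e_ (lift ord0 i)) z; last first.
    by rewrite qE dE.
  apply/funext => t.
  have lE a : adapted_map (z + a *: e_ (lift ord0 i)) =
      cmap c (eta (s, cinv c (cmap c x + a *: e_ (lift ord0 i)))).
    have l0 : (cmap c x + a *: e_ (lift ord0 i)) 0 ord0 = 0.
      by rewrite !mxE (negbTE (neq_lift _ _)) andbF mulr0 addr0 x0.
    rewrite /adapted_map /collar_point /bd_point /z addrAC set_normal_line set_normal_id//.
    by congr (cmap c (eta (_, _))); rewrite mxE l0 add0r !mxE mulr1.
  have lE0 : adapted_map z = cmap c (eta (s, cinv c (cmap c x))).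
    by rewrite -[z]addr0 -(scale0r (e_ (lift ord0 i))) lE scale0r addr0.
  by rewrite /diffq lE lE0.
have <- : G (Psi z) = g c (eta (s, x)) by rewrite /in_coords adapted_mapK// cz.
apply: (det_slice_metric regular_dom_rel_open _ _ _ _ (@box_rel_open _ _ r (cmap c x))).
- by apply: smooth_subset su => y [].
- by move=> y [Dy _]; exact: metric_chart_sym.
- by move=> y [Dy _]; exact: metric_chart_pos.
- by move=> y [].
- by move=> k; apply: smooth_subset bU _; exact: adapted_map_smooth.
- by move=> y /bU; exact: adapted_map_regular.
- move=> y k By; apply: partialE; first by case: By.
  by apply: adapted_map_flow; exact: bU.
- exact: sigma_adapted.
- exact: bz.
Qed.

End AdaptedCollar.

(** * The obstruction formula *)

Theorem theorem6 (R : realType) (n : nat) (hn : (1 <= n)%N)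
    (X : topologicalType) (A : set (chart R n X)) (hX : compact_manifold A)
    (g : tensor2 R n X) (hg : riemannian A g)
    (sigma : X -> R) (hsigma : boundary_defining A sigma)
    (J rho : X -> R) (hJ : is_J A g J) (hrho : is_rho A g sigma J rho)
    (Rem : X -> R) (hSY : singular_yamabe A g sigma rho Rem)
    (eps : R) (eta : R * X -> X)
    (heta : adapted_coordinates A g sigma eps eta)
    (h : R -> bd_tensor2 R n X) (hh : slice_metrics A g eps eta h)
    (v : R -> X -> R) (hv : volume_ratio A g eps h v)
    (x : X) (hx : bd A x) :
  let w := fun s : R => dpos 1 (fun t => v t x) s / v s x in
  (n.+1)`!%:R * Rem x =
    - 2 * dpos n w 0
    + 4 * (\sum_(1 <= j < n.+1)
             j%:R * 'C(n, j)%:R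
             * dpos (j - 1)%N (fun s => rho (eta (s, x))) 0
             * dpos (n - j)%N w 0)
    - (2 * n)%:R * dpos (n - 1)%N (fun s => J (eta (s, x))) 0.
Proof.
have log_deriv (a q d : R) : a != 0 -> q != 0 ->
    (0 * q + a * ((2 * q)^-1 * d)) / (a * q) = d / (2 * q ^+ 2).
  by move=> a0 q0; field; rewrite a0 q0.
move=> w; have [c [Ac cx x0]] := hx.
have hA := manifold_atlas hX.
have eps0 := adapted_eps heta.
have [W [oW bdW sRem SY]] := hSY.
pose G := in_coords g c; pose u := sigma \o cinv c; pose asq := coord_cosqnorm G u.
pose z0 := cmap c x.
pose Psi := adapted_map c eta; pose cpt := collar_point c.
pose U := adapted_dom c eps eta; pose V := regular_dom c g sigma.
have Dz0 : (cmap c @` cdom c) z0 by exists x.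
have cz0 : cpt z0 = (0, x).
  by rewrite -[z0]addr0 -(scale0r (delta_mx 0 ord0)); exact: (collar_point_line hA Ac).
have ex0 : eta (cpt z0) = x by rewrite cz0 (adapted_start heta).
have [Uz0 Pz0] := adapted_map_bd hA Ac heta Dz0 x0 eps0.
have oU : rel_open U := adapted_dom_rel_open hA Ac heta.
have oV : rel_open V := regular_dom_rel_open hA Ac hg hsigma.
have sPsiU k : smooth_on U (fun z => Psi z 0 k) := adapted_map_smooth hA Ac heta k.
have oUW : rel_open [set z | U z /\ W (eta (cpt z))].
  apply: rel_open_preimage => //.
  by apply: continuous_subspaceW (eta_collar_continuous hA Ac heta) => z [].
(* The flow stays where the expansion of the singular Yamabe condition is valid,
   and where the adapted map is a local diffeomorphism. *)
have oUWJ : rel_open [set z | [set z | U z /\ W (eta (cpt z))] z /\ \det (jac Psi z) != 0].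
  apply: (rel_open_preimage (W := [set t : R | t != 0]) oUW); last exact: open_neq.
  apply: (@continuous_subspaceW _ _ _ U); first by move=> z [].
  by apply/smooth_continuous/smooth_det => // k i; exact: smooth_jac.
(* A box is needed for [sigma_adapted], as flow lines must not leave the domain. *)
have [r r0 rB] : exists2 r, 0 < r & box r z0 `<=`
    [set z | [set z | U z /\ W (eta (cpt z))] z /\ \det (jac Psi z) != 0].
  apply: rel_open_box oUWJ _; split.
    by split; [exact: Uz0|rewrite ex0; exact: bdW].
  exact: (jac_adapted_bd hA Ac hg hsigma heta Dz0 x0).
pose B := box r z0.
have oB : rel_open B := @box_rel_open _ _ r z0.
have BU : B `<=` U by move=> z /rB[[]].
have Bz0 : B z0 by apply: box_center => //; exact: (oU _ Uz0).1.
have sPsi k : smooth_on B (fun z => Psi z 0 k) := smooth_subset BU (sPsiU k).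
have PsiV z : B z -> V (Psi z).
  by move=> /BU; exact: (adapted_map_regular hA Ac hg heta).
have Psi_flow z k : B z ->
    partial ord0 (fun y => Psi y 0 k) z = flow_field G u (Psi z) 0 k.
  move=> Bz; apply: partialE; first by case: Bz.
  by apply: (adapted_map_flow hA Ac hg heta); exact: BU.
have Psi_u : forall z, B z -> u (Psi z) = z 0 ord0.
  exact: (sigma_adapted hA Ac hg hsigma heta x0 BU).
have jac0 z : B z -> \det (jac Psi z) != 0 by move=> /rB[].
have VD : V `<=` cmap c @` cdom c by move=> z [].
have sG i j : smooth_on V (fun z => G z i j).
  exact: smooth_subset VD (metric_chart_smooth Ac hg i j).
have su : smooth_on V u := smooth_subset VD (bdf_chart_smooth Ac hsigma).
have Gpos z : V z -> forall y : 'rV_n.+1, y != 0 -> 0 < (y *m G z *m y^T) 0 0.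
  by move=> /VD; exact: (metric_chart_pos hA Ac hg).
have asq0 z : V z -> asq z != 0 by case.
pose rho' z := rho (eta (cpt z)); pose J' z := J (eta (cpt z)).
pose Q := (Rem \o cinv c) \o Psi; pose lv := log_vol' G u Psi.
have cB z : B z -> cdom c (eta (cpt z)) by move=> /BU[].
have J'E z : B z -> (2 * n)%:R * J' z = coord_scal G (Psi z).
  by move=> Bz; exact: (hJ _ _ Ac (cB _ Bz)).
have sigmaE z : B z -> sigma (eta (cpt z)) = z 0 ord0.
  by move=> Bz; rewrite -Psi_u// /u /= (adapted_mapK hA Ac (BU _ Bz)).
have rho'E z : B z -> n.+1%:R * rho' z = - coord_laplacian G u (Psi z) - z 0 ord0 * J' z.
  by move=> Bz; rewrite (hrho _ _ Ac (cB _ Bz)) sigmaE.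
have n0 : (2 * n)%:R != 0 :> R by rewrite pnatr_eq0 muln_eq0 -lt0n.
have sJ : smooth_on B J'.
  apply: (smooth_eq oB (f := fun z => (2 * n)%:R^-1 * (coord_scal G \o Psi) z)).
    by move=> z Bz; rewrite /= -J'E// mulKf.
  apply: smoothM => //; first exact: smooth_cst.
  exact: smooth_comp oB oV (smooth_scal oV sG Gpos) PsiV sPsi.
have srho : smooth_on B rho'.
  apply: (smooth_eq oB (f := fun z => n.+1%:R^-1 *
      (- (coord_laplacian G u \o Psi) z - z 0 ord0 * J' z))).
    by move=> z Bz; rewrite /= -rho'E// mulKf// pnatr_eq0.
  apply: smoothM => //; first exact: smooth_cst.
  apply: smoothB => //; last by apply: smoothM => //; exact: smooth_coord.
  by apply: smoothN => //; exact: smooth_comp oB oV (smooth_laplacian oV sG su Gpos) PsiV sPsi.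
have sQ : smooth_on B Q.
  apply: (smooth_comp oB (chart_image_open_rel_open hA Ac oW) (sRem _ Ac) _ sPsi).
  by move=> z Bz; exists (eta (cpt z)) => //; split; [have [[]] := rB _ Bz|exact: cB].
have slv : smooth_on B lv := smooth_log_vol' oV sG su Gpos asq0 oB sPsi PsiV jac0.
have sa : smooth_on B (asq \o Psi) := smooth_asq_Psi oV sG su Gpos oB sPsi PsiV.
have [z00 Hz0] : z0 0 ord0 = 0 /\ halfspace z0 by split=> //; case: Bz0.
have Qz0 : Q z0 = Rem x by rewrite /Q /= (adapted_mapK hA Ac Uz0) ex0.
rewrite -Qz0.
have SY' z : B z -> (asq \o Psi) z + 2 * z 0 ord0 * rho' z = 1 + z 0 ord0 ^+ n.+1 * Q z.
  move=> Bz; have [[_ Wz] _] := rB _ Bz; have := SY _ _ Ac Wz (cB _ Bz).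
  by rewrite sigmaE// /Q /= (adapted_mapK hA Ac (BU _ Bz)).
have lapl z : B z -> n.+1%:R * rho' z =
    - ((asq \o Psi) z * lv z + 2^-1 * partial ord0 (asq \o Psi) z) - z 0 ord0 * J' z.
  move=> Bz; rewrite rho'E//.
  by rewrite (laplacian_log_vol' oV sG su Gpos asq0 oB sPsi PsiV Psi_flow jac0 Bz).
rewrite (obstruction_expansion oB hn sa slv srho sJ sQ SY' lapl Bz0 z00).
have rI : 0 <= (0 : R) < r by rewrite lexx.
have line0 (F : 'rV_n.+1 -> R) : F (z0 + 0 *: delta_mx 0 ord0) = F z0.
  by rewrite scale0r addr0.
have linecpt s : cpt (z0 + s *: delta_mx 0 ord0) = (s, x) by exact: (collar_point_line hA Ac).
have dposE (F : 'rV_n.+1 -> R) (f : R -> R) k :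
    (forall t, 0 <= t < r -> f t = F (z0 + t *: delta_mx 0 ord0)) ->
    dpos k f 0 = iter k (partial ord0) F z0.
  by move=> fF; rewrite (dpos_line z00 fF k rI) line0.
pose K := (Num.sqrt (\det (bd_metric g c x)))^-1.
have K0 : K != 0.
  by rewrite invr_eq0 gt_eqF// sqrtr_gt0; exact: (bd_metric_det_gt0 Ac hg).
have vE t : 0 <= t < r -> v t x = K * Num.sqrt (vol_sq G u Psi (z0 + t *: delta_mx 0 ord0)).
  exact: (volume_ratio_adapted hA Ac hg hsigma heta hh hv cx x0 BU).
(* The constant density of the boundary metric cancels in v' / v. *)
have wE t : 0 <= t < r -> w t = lv (z0 + t *: delta_mx 0 ord0).
  move=> tI; have Bt : B (z0 + t *: delta_mx 0 ord0) by exact: box_line.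
  have F0 := vol_sq_gt0 Gpos asq0 PsiV jac0 Bt.
  rewrite /w (vE _ tI) (dpos_line (F := fun z => K * Num.sqrt (vol_sq G u Psi z)) z00 vE 1 tI) /=.
  have sF := smooth_vol_sq oV sG su Gpos oB sPsi PsiV.
  have hF := has_partial_sqrt F0 (smooth_has_partial (i := ord0) sF Bt).
  rewrite (partialE (oB _ Bt).1 (has_partialM (has_partial_cst _ K _) hF)) /lv /log_vol'.
  by rewrite log_deriv ?(gt_eqF (_ : 0 < Num.sqrt _)) ?sqrtr_gt0// sqr_sqrtr ?ltW.
have dpos_w k : dpos k w 0 = iter k (partial ord0) lv z0 by exact: dposE.
have dpos_rho k : dpos k (fun s => rho (eta (s, x))) 0 = iter k (partial ord0) rho' z0.
  by apply: dposE => t _; rewrite /rho' linecpt.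
have dpos_J k : dpos k (fun s => J (eta (s, x))) 0 = iter k (partial ord0) J' z0.
  by apply: dposE => t _; rewrite /J' linecpt.
rewrite dpos_w dpos_J; congr (_ + 4 * _ - _).
by apply: eq_bigr => j _; rewrite dpos_w dpos_rho.
Qed.
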